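(* Let $p\ge 1$, let $\gamma_1,\dots,\gamma_p>0$ be fixed, and suppose the patch geometry assumption stated in the context holds, with integer $l$ and maximal mesh size $h_0$. Then there is a constant $C$ independent of $h$ such that for all $h\in(0,h_0]$, all $\hat K\in\hat{\mathcal K}_{h,i}$ with $\hat K\cap\hat\Gamma_i\ne\emptyset$, and all $\hat v\in\hat V_{h,i}$, $$\|\hat v\|^2_{\hat K}\le C\big(\|\hat v\|^2_{\mathcal N_l(\hat K)\cap\hat\Omega_i}+\|\hat v\|^2_{j_{h,\mathcal F(\mathcal N_l(\hat K))}}\big),$$ where $\mathcal F(\mathcal N_l(\hat K))$ is the set of interior faces in the neighbourhood $\mathcal N_l(\hat K)$.
   Context: $\hat\Omega_i\subset[0,1]^2$ is a reference patch whose boundary $\hat\Gamma_i=\partial\hat\Omega_i$ consists of finitely many smooth curves. $\hat{\mathcal K}_{h,i,0}$ is a uniform structured tensor product (square) mesh of $[0,1]^2$ with mesh size $h$; the active mesh is $\hat{\mathcal K}_{h,i}=\{\hat K\in\hat{\mathcal K}_{h,i,0}:\hat K\cap\hat\Omega_i\ne\emptyset\}$. $\hat V_{h,i}$ is the space of continuous piecewise tensor product polynomials of order $p$ on $\hat{\mathcal K}_{h,i,0}$, restricted to the active mesh. $\|\cdot\|_\omega$ is the $L^2(\omega)$ norm. For a set of faces $\hat{\mathcal F}$, $$\|\hat v\|^2_{j_{h,\hat{\mathcal F}}}=\sum_{k=1}^p\gamma_kh^{2k-1}\|\llbracket\hat D_n^k\hat v\rrbracket\|^2_{\hat{\mathcal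 F}},$$ where $\llbracket\cdot\rrbracket$ is the jump across the face and $\hat D_n^k$ the $k$-th derivative in the Euclidean face normal direction. Patch geometry assumption. For an element $\hat K\in\hat{\mathcal K}_{h,i}$ let $\mathcal N_0(\hat K)=\hat K$ and for $l=1,2,\dots$ let $\mathcal N_l(\hat K)$ be the union of all elements of the active mesh that share a face or a node with an element in $\mathcal N_{l-1}(\hat K)$. There are a positive integer $l$, a maximal mesh size $h_0>0$ and a constant $c>0$ such that for all $h\in(0,h_0]$ and all $\hat K\in\hat{\mathcal K}_{h,i}$ with $\hat K\cap\hat\Gamma_i\neq\emptyset$ there is an element $\hat K'\subset\mathcal N_l(\hat K)$ with $|\hat K'\cap\hat\Omega_i|\ge c|\hat K|$. *)

(* Defs.v *)
From HB Require Import structures.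
From mathcomp Require Import all_boot all_order all_algebra.
From mathcomp Require Import all_classical all_reals all_analysis.

Set Implicit Arguments.
Unset Strict Implicit.
Unset Printing Implicit Defensive.

Import Order.TTheory GRing.Theory Num.Theory numFieldNormedType.Exports.

Local Open Scope classical_set_scope.
Local Open Scope ring_scope.

(* [R * R] with its Borel sigma-algebra. *)
Notation mplane R := (measurableTypeR R * measurableTypeR R)%type.

Definition area (R : realType) : set (mplane R) -> \bar R :=
  (@lebesgue_measure R \x @lebesgue_measure R)%E.

Section PlaneSets.
Variable R : realType.

Definition unit_square : set (R * R) := `[0, 1] `*` `[0, 1].

Definition boundary (A : set (R * R)) : set (R * R) := closure A `\` interior A.

(* Regular C^oo parametrizations [0, 1] -> R^2. They are taken as restrictions
   of C^oo maps on R, which is no loss: a function smooth up to the end points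
   of [0, 1] extends smoothly to R. Only the velocity on [0, 1] is required to
   be nonzero. Curves may be closed, may cross, and may share end points. *)
Definition smooth_param (a b : R -> R) : Prop :=
  (forall (n : nat) (t : R), derivable (derive1n n a) t 1 /\ derivable (derive1n n b) t 1) /\
  (forall t : R, 0 <= t <= 1 -> (derive1 a t, derive1 b t) <> (0, 0)).

Definition smooth_curve (S : set (R * R)) : Prop :=
  exists a b : R -> R,
    smooth_param a b /\ S = [set (a t, b t) | t in `[0, 1]].

Definition finitely_many_smooth_curves (S : set (R * R)) : Prop :=
  exists (m : nat) (G : 'I_m -> set (R * R)),
    (forall i, smooth_curve (G i)) /\ S = \bigcup_(i in [set: 'I_m]) G i.

(* No openness or closedness is imposed: measurability only gives a meaning to
   the areas |K `&` Omega|. *)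
Definition reference_patch (Omega : set (R * R)) : Prop :=
  [/\ Omega `<=` unit_square,
      measurable (Omega : set (mplane R)) &
      finitely_many_smooth_curves (boundary Omega)].

End PlaneSets.

Section Mesh.
Variables (R : realType) (N : nat).

(* Elements, nodes and faces of the N x N mesh are given by integer indices.
   Node (a, b) is the point (a h, b h). Face (true, (a, b)) is the vertical
   segment {a h} x [b h, (b+1) h] and face (false, (a, b)) the horizontal
   segment [a h, (a+1) h] x {b h}; the index set also contains pairs that are
   the face of no element, which are harmless as faces are only used through
   [face_of]. *)
Definition cell : Type := ('I_N * 'I_N)%type.
Definition node : Type := ('I_N.+1 * 'I_N.+1)%type.
Definition face : Type := (bool * ('I_N.+1 * 'I_N.+1))%type.

Definition node_of (K : cell) (P : node) : bool :=
  [&& (P.1 == K.1 :> nat) || (P.1 == K.1.+1 :> nat) &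
      (P.2 == K.2 :> nat) || (P.2 == K.2.+1 :> nat)].

Definition face_of (K : cell) (F : face) : bool :=
  let: (vertical, (a, b)) := F in
  if vertical
  then ((a == K.1 :> nat) || (a == K.1.+1 :> nat)) && (b == K.2 :> nat)
  else (a == K.1 :> nat) && ((b == K.2 :> nat) || (b == K.2.+1 :> nat)).

Definition share_face_or_node (K K' : cell) : Prop :=
  (exists F : face, face_of K F /\ face_of K' F) \/
  (exists P : node, node_of K P /\ node_of K' P).

Variable h : R.

(* Elements are closed squares. *)
Definition cell_dom (K : cell) : set (R * R) :=
  `[K.1%:R * h, K.1.+1%:R * h] `*` `[K.2%:R * h, K.2.+1%:R * h].

Definition union_dom (S : set cell) : set (R * R) :=
  \bigcup_(K in S) cell_dom K.

Definition active (Omega : set (R * R)) : set cell :=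
  [set K | cell_dom K `&` Omega !=set0].

Fixpoint nbhd (Omega : set (R * R)) (l : nat) (K : cell) : set cell :=
  if l is l'.+1 then
    [set K' | active Omega K' /\
       exists2 K'', nbhd Omega l' K K'' & share_face_or_node K' K'']
  else [set K].

Definition interior_faces (S : set cell) : set face :=
  [set F | exists K K' : cell,
     [/\ S K, S K', K <> K', face_of K F & face_of K' F]].

Definition tensor_poly_on (p : nat) (K : cell) (w : R * R -> R) : Prop :=
  exists c : 'I_p.+1 -> 'I_p.+1 -> R, forall z : R * R, cell_dom K z ->
    w z = \sum_(i < p.+1) \sum_(j < p.+1) c i j * z.1 ^+ i * z.2 ^+ j.

Definition background_space (p : nat) (w : R * R -> R) : Prop :=
  {within @unit_square R, continuous w} /\
  (forall K : cell, tensor_poly_on p K w).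

(* Functions on the active region are represented by total functions whose
   values elsewhere are arbitrary and never used. *)
Definition active_space (Omega : set (R * R)) (p : nat) (v : R * R -> R) :
    Prop :=
  exists2 w, background_space p w &
    forall z, union_dom (active Omega) z -> v z = w z.

(* Traces on a face are limits, along the face normal, of the k-th derivative
   in the normal direction. The point of the face F is parametrized by its
   coordinate s along F. The orientation of the normal is irrelevant, as only
   squares of jumps are used. *)
Definition normal_jump (v : R * R -> R) (k : nat) (F : face) (s : R) : R :=
  let: (vertical, (a, b)) := F in
  let slice t := if vertical then v (t, s) else v (s, t) in
  let x0 : R := (if vertical then a : nat else b)%:R * h in
  lim (derive1n k slice t @[t --> x0^'+]) - lim (derive1n k slice t @[t --> x0^'-]).

Definition face_range (F : face) : set R :=
  let: (vertical, (a, b)) := F in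
  let s : nat := if vertical then b : nat else a in
  `[s%:R * h, s.+1%:R * h].

Definition jump_L2sq (v : R * R -> R) (k : nat) (FF : set face) : \bar R :=
  (\sum_(F : face | F \in FF)
     \int[@lebesgue_measure R]_(s in face_range F)
       ((normal_jump v k F s) ^+ 2)%:E)%E.

Definition ghost_normsq (p : nat) (gamma : nat -> R) (FF : set face)
    (v : R * R -> R) : \bar R :=
  (\sum_(1 <= k < p.+1)
     (gamma k * h ^+ (2 * k - 1))%:E * jump_L2sq v k FF)%E.

End Mesh.

Definition L2sq (R : realType) (D : set (R * R)) (v : R * R -> R) : \bar R :=
  (\int[@area R]_(z in (D : set (mplane R))) ((v z) ^+ 2)%:E)%E.

(* A uniform square mesh of [0, 1]^2 of mesh size (side length) h. *)
Definition mesh_size (R : realType) (N : nat) (h : R) : Prop := N%:R * h = 1.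

Definition patch_geometry (R : realType) (Omega : set (R * R)) (l : nat)
    (h0 : R) : Prop :=
  [/\ (0 < l)%N, 0 < h0 & exists2 c : R, 0 < c &
    forall (N : nat) (h : R), mesh_size N h -> 0 < h <= h0 ->
    forall K : cell N, active h Omega K ->
      cell_dom h K `&` boundary Omega !=set0 ->
      exists2 K' : cell N, nbhd h Omega l K K' &
        (c%:E * @area R (cell_dom h K) <= @area R (cell_dom h K' `&` Omega))%E].

(* Main.v *)
Require Import Defs.
From mathcomp Require Import all_boot all_order all_algebra.
From mathcomp Require Import all_classical all_reals all_analysis measurable_realfun.
From mathcomp Require Import ring lra zify.

Set Implicit Arguments.
Unset Strict Implicit.
Unset Printing Implicit Defensive.

Import Order.TTheory GRing.Theory Num.Theory numFieldNormedType.Exports.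

Local Open Scope classical_set_scope.
Local Open Scope ring_scope.

(* A polynomial is controlled on a square by its L2 norm on any subset of
   proportional area (Remez), and it is carried across a face by the jumps of
   its normal derivatives (Taylor expansion in the normal direction). What is
   left is to join K, through faces of the neighbourhood, to an element with a
   proportional share of Omega, although the patch geometry assumption only
   provides a chain of elements sharing nodes.

   The assumption at all mesh sizes implies that Omega has positive density, at
   every small scale, around each of its points. Hence a point of Omega in K away
   from the vertices gives K or a face neighbour a proportional share. Near a
   vertex P the only obstruction is that the share lies in the element opposite
   to K at P while the two elements in between are inactive. A boundary curve
   that enters K near P is then trapped: it can only leave through P, and by local
   injectivity at most once, so one of its end points lies in K near P. Such
   arcs seen from P lie in thin cones around finitely many end tangents. Every
   point of Omega in K near P lies on a ray from P through such an arc, so Omega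
   is confined to these cones, against its density. *)

(** * Remez inequalities *)

(** Cells that meet only at a node are not compared by any term of the penalty, which is why the
    chain in the assumption cannot be followed. It is used only to get a density constant [c1], and
    this with auxiliary meshes unrelated to the given one. A new path is then built, and it crosses
    at most two faces, because an element touching K at a vertex only is two faces away. The path
    stays in the first neighbourhood, which is part of the l-th one. The constants are fixed in an
    order that keeps them independent of h: the density constant [c1] and the number of boundary
    curves give the opening [w] of the cones; [w] and the curves give a radius [rho], the scale
    below which the trapping argument works; the scale examined near a vertex is a fixed fraction of
    h, bounded by [rho]. No power of h is lost at a face. The Taylor term of order k contributes
    h^(2k) and evaluating a polynomial at a point of the face costs 1/h, which is the weight
    h^(2k-1) of the penalty. *)

Lemma lebesgue_measure_segment (R : realType) (a b : R) : a <= b ->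
  (@lebesgue_measure R `[a, b] = (b - a)%:E)%E.
Proof.
move=> ab; rewrite lebesgue_measure_itv/= lte_fin.
by move: ab; rewrite le_eqVlt => /predU1P[->|->//]; rewrite ltxx subrr.
Qed.

(** Induction on the degree: with [x0] in [E], write [f - f(x0) = g (X - x0)]. Removing from [E] the
    ball of radius [r = e L / 4], of length [e L / 2], leaves at least half of the required length,
    and there [|g| <= 2 s / r]. The induction hypothesis for [e / 2] bounds [g] on the segment,
    whence [1 + 8 C / e]. *)
Lemma poly_sup_of_large_set (R : realType) (n : nat) (e : R) : 0 < e ->
  exists2 C : R, 1 <= C & forall (f : {poly R}) (a L s : R) (E : set R),
    (size f <= n)%N -> 0 < L -> measurable E -> E `<=` `[a, a + L] ->
    ((e * L)%:E <= lebesgue_measure E)%E ->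
    (forall x, E x -> `|f.[x]| <= s) ->
    forall x, x \in `[a, a + L] -> `|f.[x]| <= C * s.
Proof.
elim: n e => [|n IH] e e0.
  exists 1 => // f a L s E; rewrite leqn0 size_poly_eq0 => /eqP-> L0 mE EI eE fs x xI.
  have [x0 Ex0] : E !=set0.
    apply/set0P/eqP => E0; move: eE.
    by rewrite E0 measure0 lee_fin leNgt mulr_gt0.
  by have := fs _ Ex0; rewrite !horner0 normr0 mul1r.
have [C C1 HC] := IH (e / 2) (divr_gt0 e0 (ltr0Sn _ 1)).
exists (1 + 8 * C / e); first by rewrite lerDl divr_ge0// ?(ltW e0)//; lra.
move=> f a L s E sf L0 mE EI eE fs x xI.
have [x0 Ex0] : E !=set0.
  apply/set0P/eqP => E0; move: eE.
  by rewrite E0 measure0 lee_fin leNgt mulr_gt0.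
have s0 : 0 <= s by apply: le_trans (fs _ Ex0).
have /factor_theorem[g fg] : root (f - f.[x0]%:P) x0.
  by rewrite /root !hornerE subrr.
have fE y : f.[y] = f.[x0] + g.[y] * (y - x0).
  have -> : f = f.[x0]%:P + g * ('X - x0%:P) by rewrite -fg addrC subrK.
  by rewrite !hornerE subrr mulr0 addr0.
have sg : (size g <= n)%N.
  have [->|g0] := eqVneq g 0; first by rewrite size_poly0.
  have : (size (f - f.[x0]%:P)%R <= n.+1)%N.
    rewrite (leq_trans (size_polyD _ _))// geq_max sf size_polyN.
    by rewrite (leq_trans (size_polyC_leq1 _)).
  by rewrite fg size_Mmonic ?monicXsubC// size_XsubC addn2.
pose r := e * L / 4.
have r0 : 0 < r by rewrite /r; apply: divr_gt0 => //; exact: mulr_gt0.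
pose E' := E `\` ball x0 r.
have mE' : measurable E' by apply: measurableD => //; exact: measurable_ball.
have E'E : E' `<=` E by move=> y [].
have eE' : ((e / 2 * L)%:E <= lebesgue_measure E')%E.
  have le1 : (lebesgue_measure E <= lebesgue_measure E' + lebesgue_measure (ball x0 r))%E.
    apply: le_trans (measureU2 _ _ _) => //; last exact: measurable_ball.
    apply: le_measure; rewrite ?inE//.
      by apply: measurableU => //; exact: measurable_ball.
    by move=> y Ey; have [yb|yb] := pselect (ball x0 r y); [right|left].
  move: (le_trans eE le1); rewrite lebesgue_measure_ball; last exact: ltW.
  rewrite -leeBlDr// -EFinB; apply: le_trans; rewrite lee_fin /r; lra.
have gs y : E' y -> `|g.[y]| <= 2 * s / r.
  move=> [Ey yr]; have {}yr : r <= `|x0 - y| by rewrite leNgt; apply/negP.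
  rewrite ler_pdivlMr//; apply: (@le_trans _ _ (`|g.[y]| * `|y - x0|)).
    by rewrite ler_wpM2l// distrC.
  rewrite -normrM -[X in `|X|](addKr f.[x0]) -fE.
  rewrite (le_trans (ler_normD _ _))// normrN.
  by have := fs _ Ey; have := fs _ Ex0; lra.
have gx := HC g a L _ E' sg L0 mE' (subset_trans E'E EI) eE' gs x xI.
rewrite fE (le_trans (ler_normD _ _))// normrM mulrDl mul1r lerD// ?fs//.
have xx0 : `|x - x0| <= L.
  by move: xI (EI _ Ex0); rewrite /= !in_itv/= ler_norml => /andP[? ?] /andP[? ?]; lra.
apply: (le_trans (ler_pM _ _ gx xx0)) => //.
rewrite le_eqVlt; apply/orP; left; apply/eqP; rewrite /r; field.
by rewrite !gt_eqF.
Qed.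

Lemma sq_integral_ge d (T : measurableType d) (R : realType)
    (mu : {measure set T -> \bar R}) (D : set T) (f : T -> R) (m s : R) :
  measurable D -> measurable_fun D f -> 0 <= s ->
  (m%:E <= mu (D `&` [set x | (s < `|f x|)%R]))%E ->
  ((s ^+ 2 * m)%:E <= \int[mu]_(x in D) ((f x) ^+ 2)%:E)%E.
Proof.
move=> mD mf s0 mm; set A := D `&` _ in mm.
have mn : measurable_fun D (fun x => `|f x|) by exact: measurableT_comp.
have mA : measurable A.
  have -> : A = D `&` (fun x => `|f x|) @^-1` `]s, +oo[%classic.
    by apply/seteqP; split => x [Dx] /=; rewrite in_itv/= andbT.
  exact: (mn _ _ (measurable_itv _)).
have mf2 : measurable_fun D (fun x => ((f x) ^+ 2)%:E).
  by apply/measurable_EFinP; exact: measurable_funX.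
apply: (@le_trans _ _ (\int[mu]_(x in A) (s ^+ 2)%:E)%E).
  rewrite integral_cst// EFinM; apply: lee_wpmul2l => //; rewrite lee_fin; exact: sqr_ge0.

apply: (@le_trans _ _ (\int[mu]_(x in A) ((f x) ^+ 2)%:E)%E).
  apply: ge0_le_integral => //.
  - by move=> x _; rewrite lee_fin sqr_ge0.
  - by apply: measurable_funS mf2 => // x [].
  - by move=> x [_ /= sx]; rewrite lee_fin -(real_normK (num_real (f x))) lerXn2r ?nnegrE// ltW.
apply: ge0_subset_integral => //.
- by move=> x _; rewrite lee_fin sqr_ge0.
- by move=> x [].
Qed.

(** Turns a sup bound of Remez type into an L2 bound, in dimension one and two alike. With
    [s = |v| / (2 C)], the set where [|f| <= s] has measure below [m / 2], since otherwise
    [|v| <= |v| / 2]. So [|f| > s] on measure at least [m / 2], and Chebyshev's inequality gives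
    [v^2 m / (8 C^2)]. *)
Lemma sup_le_sq_integral d (T : measurableType d) (R : realType)
    (mu : {measure set T -> \bar R}) (S : set T) (f : T -> R) (m C v : R) :
  measurable S -> measurable_fun S f -> 0 < m -> 0 < C ->
  (m%:E <= mu S)%E ->
  (forall (E : set T) (s : R), measurable E -> E `<=` S ->
     ((m / 2)%:E <= mu E)%E -> (forall x, E x -> `|f x| <= s) -> `|v| <= C * s) ->
  ((v ^+ 2)%:E <= (8 * C ^+ 2 / m)%:E * \int[mu]_(x in S) ((f x) ^+ 2)%:E)%E.
Proof.
move=> mS mf m0 C0 mmu H.
have [->|vn0] := eqVneq v 0.
  rewrite expr0n/=; apply: mule_ge0.
    by rewrite lee_fin divr_ge0 ?(ltW m0)// mulr_ge0 ?sqr_ge0.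
  by apply: integral_ge0 => x _; rewrite lee_fin sqr_ge0.
have v0 : 0 < `|v| by rewrite normr_gt0.
pose s := `|v| / (2 * C).
have s0 : 0 < s by rewrite divr_gt0// mulr_gt0.
pose E := S `&` [set x | `|f x| <= s].
have mn : measurable_fun S (fun x => `|f x|) by exact: measurableT_comp.
have mE : measurable E.
  have -> : E = S `&` (fun x => `|f x|) @^-1` `]-oo, s]%classic.
    by apply/seteqP; split => x [Dx] /=; rewrite in_itv/=.
  exact: (mn _ _ (measurable_itv _)).
pose A := S `&` [set x | s < `|f x|].
have mA : measurable A.
  have -> : A = S `&` (fun x => `|f x|) @^-1` `]s, +oo[%classic.
    by apply/seteqP; split => x [Dx] /=; rewrite in_itv/= andbT.
  exact: (mn _ _ (measurable_itv _)).
have mA2 : ((m / 2)%:E <= mu A)%E.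
  rewrite leNgt; apply/negP => ltA.
  have ltE : (mu E < (m / 2)%:E)%E.
    rewrite ltNge; apply/negP => leE.
    have ES : E `<=` S by move=> x [].
    have fE x : E x -> `|f x| <= s by case.
    have := H E s mE ES leE fE.
    have -> : C * s = `|v| / 2 by rewrite /s; field; rewrite gt_eqF.
    lra.
  have : (mu S <= mu E + mu A)%E.
    apply: le_trans (measureU2 _ _ _) => //.
    apply: le_measure; rewrite ?inE//; first exact: measurableU.
    by move=> x Sx; have [le|lt] := leP (`|f x|) s; [left|right].
  move=> /(le_trans mmu); apply/negP; rewrite -ltNge.
  have -> : m%:E = ((m / 2)%:E + (m / 2)%:E)%E by rewrite -EFinD -splitr.
  exact: lteD.
have := sq_integral_ge mS mf (ltW s0) mA2.
rewrite -(@lee_pmul2l _ (8 * C ^+ 2 / m)%:E) ?lte_fin; last 2 first.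
  by [].
  by rewrite divr_gt0// mulr_gt0// exprn_gt0.
apply: le_trans; rewrite -EFinM lee_fin -(real_normK (num_real v)).
rewrite le_eqVlt; apply/orP; left; apply/eqP; rewrite /s; field.
by rewrite !gt_eqF.
Qed.

Lemma poly_sup_le_L2 (R : realType) (n : nat) (e : R) : 0 < e ->
  exists2 C : R, 0 < C & forall (f : {poly R}) (a L : R) (E : set R),
    (size f <= n)%N -> 0 < L -> measurable E -> E `<=` `[a, a + L] ->
    ((e * L)%:E <= lebesgue_measure E)%E ->
    forall x, x \in `[a, a + L] ->
    ((f.[x] ^+ 2)%:E <= (C / L)%:E *
       \int[@lebesgue_measure R]_(y in E) (f.[y] ^+ 2)%:E)%E.
Proof.
move=> e0.
have [C C1 H] := poly_sup_of_large_set n (divr_gt0 e0 (ltr0Sn R 1)).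
have C0 : 0 < C by exact: lt_le_trans C1.
exists (8 * C ^+ 2 / e); first by rewrite divr_gt0// mulr_gt0// exprn_gt0.
move=> f a L E sf L0 mE EI eE x xI.
have -> : 8 * C ^+ 2 / e / L = 8 * C ^+ 2 / (e * L) by field; rewrite !gt_eqF.
apply: sup_le_sq_integral => //; last 2 first.
- exact: mulr_gt0.
- move=> E' s mE' E'E leE' fE'.
  apply: (H f a L s E') => //; first exact: subset_trans EI.
  by rewrite mulrAC.
apply: measurable_funTS; exact: continuous_measurable_fun (@continuous_horner _ _).
Qed.

(** Unlike in [tensor_poly_on], the formula holds on the whole plane, so that the polynomial of one
    element can be evaluated on its neighbours. *)
Definition tensor_poly (R : realType) (p : nat) (q : R * R -> R) : Prop :=
  exists c : 'I_p.+1 -> 'I_p.+1 -> R,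
    forall z, q z = \sum_(i < p.+1) \sum_(j < p.+1) c i j * z.1 ^+ i * z.2 ^+ j.

Lemma tensor_poly_fst (R : realType) (p : nat) (q : R * R -> R) (y : R) :
  tensor_poly p q ->
  exists2 f : {poly R}, (size f <= p.+1)%N & forall x, q (x, y) = f.[x].
Proof.
move=> [c H]; exists (\poly_(i < p.+1) (\sum_(j < p.+1) c (inord i) j * y ^+ j)).
  exact: size_poly.
move=> x; rewrite H horner_poly; apply: eq_bigr => i _ /=.
rewrite inord_val mulr_suml; apply: eq_bigr => j _.
by rewrite mulrAC.
Qed.

Lemma tensor_poly_swap (R : realType) (p : nat) (q : R * R -> R) :
  tensor_poly p q -> tensor_poly p (fun z => q (z.2, z.1)).
Proof.
move=> [c H]; exists (fun i j => c j i) => z /=.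
rewrite H exchange_big; apply: eq_bigr => i _; apply: eq_bigr => j _ /=.
by rewrite mulrAC.
Qed.

Lemma tensor_poly_snd (R : realType) (p : nat) (q : R * R -> R) (x : R) :
  tensor_poly p q ->
  exists2 f : {poly R}, (size f <= p.+1)%N & forall y, q (x, y) = f.[y].
Proof. by move=> /tensor_poly_swap/(tensor_poly_fst x)[f sf H]; exists f. Qed.

Lemma tensor_poly_measurable (R : realType) (p : nat) (q : mplane R -> R) :
  tensor_poly p q -> measurable_fun setT q.
Proof.
move=> [c H].
have -> : q = (fun z : mplane R => \sum_(i < p.+1) \sum_(j < p.+1) c i j * z.1 ^+ i * z.2 ^+ j)
  by apply/funext.
apply: measurable_sum => i; apply: measurable_sum => j.
apply: measurable_funM; last first.
  by apply: measurable_funX; exact: measurable_snd.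
apply: measurable_funM => //.
by apply: measurable_funX; exact: measurable_fst.
Qed.

Lemma area_rect (R : realType) (a b c d : R) : a <= b -> c <= d ->
  @area R (`[a, b] `*` `[c, d]) = ((b - a) * (d - c))%:E.
Proof.
move=> ab cd; rewrite /area product_measure1E; try exact: measurable_itv.
by rewrite EFinM; congr (_ * _)%E; exact: lebesgue_measure_segment.
Qed.

Lemma areaE (R : realType) (E : set (mplane R)) :
  @area R E = (\int[@lebesgue_measure R]_x lebesgue_measure (xsection E x))%E.
Proof. by []. Qed.

(** Cavalieri's principle with an exceptional set [F] of abscissae. It serves both to find many long
    sections in a set of large area and, with [F] empty, to bound the area of a strip. *)
Lemma area_le_sections (R : realType) (a L k : R) (E : set (mplane R))
    (F : set R) (H : R) :
  measurable E -> measurable F -> 0 <= L -> 0 <= k -> 0 <= H ->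
  (forall z, E z -> z.1 \in `[a, a + L]) ->
  (forall x, x \in `[a, a + L] -> (lebesgue_measure (xsection E x) <= H%:E)%E) ->
  (forall x, x \in `[a, a + L] -> ~ F x -> (lebesgue_measure (xsection E x) <= k%:E)%E) ->
  (@area R E <= H%:E * lebesgue_measure F + (k * L)%:E)%E.
Proof.
move=> mE mF L0 k0 H0 EI EH Ek.
pose I : set R := `[a, a + L]%classic.
have mI : measurable I by exact: measurable_itv.
have -> : (k * L)%:E = (k%:E * @lebesgue_measure R I)%E.
  by rewrite /I lebesgue_measure_segment ?lerDl// addrAC subrr add0r.
have xs0 x : x \notin `[a, a + L] -> xsection E x = set0.
  move=> xI; rewrite -subset0 => y; rewrite /xsection/= inE => Exy.
  by move: xI; rewrite (EI _ Exy).
rewrite -[F]setIT -[I]setIT -integral_indic// -[X in (_ + _ * X)%E]integral_indic//.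
rewrite -ge0_integralZl//; last first.
  by apply/measurable_EFinP; exact: measurable_indic.
rewrite -[X in (_ + X)%E]ge0_integralZl//; last first.
  by apply/measurable_EFinP; exact: measurable_indic.
have mZ (r : R) (A : set R) : measurable A ->
    measurable_fun setT (fun x => (r%:E * (\1_A x)%:E)%E).
  move=> mA; apply/measurable_EFinP; apply: measurable_funM => //.
have Z0 (r : R) (A : set R) x : 0 <= r -> (0 <= r%:E * (\1_A x)%:E)%E.
  by move=> r0; apply: mule_ge0; rewrite lee_fin.
rewrite -ge0_integralD//; [|by move=> x _; exact: Z0|exact: mZ|by move=> x _; exact: Z0|exact: mZ].
rewrite areaE; apply: ge0_le_integral => //.
- exact: measurable_fun_xsection.
- by apply: emeasurable_funD; exact: mZ.
move=> x _.
have [xI|xI] := boolP (x \in `[a, a + L]); last first.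
  by rewrite xs0// measure0; apply: adde_ge0; exact: Z0.
have [Fx|Fx] := pselect (F x).
  have -> : \1_F x = 1 :> R by rewrite indicE mem_set.
  rewrite mule1.
  apply: (le_trans (EH _ xI)).
  by rewrite leeDl//; exact: Z0.
have -> : \1_I x = 1 :> R by rewrite indicE mem_set.
rewrite mule1.
apply: (le_trans (Ek _ xI Fx)).
by rewrite leeDr//; exact: Z0.
Qed.

(** The one-dimensional bound is applied twice. Let [F] be the abscissae whose section has length at
    least [e L / 2]; Fubini gives [F] length at least [e L / 2]. Each vertical line over [F] yields
    [C s] at every height, and then the horizontal line through the given point yields
    [C * C * s]. *)
Lemma tensor_poly_sup_of_large_set (R : realType) (p : nat) (e : R) : 0 < e ->
  exists2 C : R, 0 < C & forall (q : R * R -> R) (a b L s : R) (E : set (mplane R)),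
    tensor_poly p q -> 0 < L -> measurable E ->
    E `<=` `[a, a + L] `*` `[b, b + L] ->
    ((e * L ^+ 2)%:E <= @area R E)%E ->
    (forall z, E z -> `|q z| <= s) ->
    forall z, (`[a, a + L] `*` `[b, b + L]) z -> `|q z| <= C * s.
Proof.
move=> e0; have e20 : 0 < e / 2 by rewrite divr_gt0.
have [C C1 H] := poly_sup_of_large_set p.+1 e20.
exists (C * C); first by rewrite mulr_gt0// (lt_le_trans _ C1).
move=> q a b L s E tq L0 mE EI eE qs [x y] [/= xI yI].
pose F : set R := `[a, a + L] `&` [set x | ((e / 2 * L)%:E <= lebesgue_measure (xsection E x))%E].
have mF : measurable F.
  have := measurable_fun_xsection (@lebesgue_measure R) mE => ms.
  have -> : F = `[a, a + L]%classic `&` (setT `&` (lebesgue_measure \o xsection E) @^-1` [set` `[(e / 2 * L)%:E, +oo[ ]).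
    rewrite setTI; apply/seteqP; split => t [tI] /= h; (split; first exact: tI); move: h; rewrite /= ?in_itv/= ?andbT //.
  by apply: measurableI; [exact: measurable_itv | apply: ms => //; exact: emeasurable_itv].
have xsL t : (lebesgue_measure (xsection E t) <= L%:E)%E.
  have -> : L%:E = @lebesgue_measure R `[b, b + L].
    by rewrite lebesgue_measure_segment ?lerDl ?(ltW L0)// addrAC subrr add0r.
  apply: le_measure; rewrite ?inE.
  - exact: measurable_xsection.
  - exact: measurable_itv.
  - by move=> u; rewrite /xsection/= inE => /EI[].
have leF : ((e / 2 * L)%:E <= lebesgue_measure F)%E.
  have : (@area R E <= L%:E * lebesgue_measure F + (e / 2 * L * L)%:E)%E.
    apply: (@area_le_sections _ a); rewrite ?(ltW L0)//.
    - by rewrite mulr_ge0 ?ltW.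
    - by move=> z /EI[].
    - by move=> t tI nF; rewrite leNgt; apply/negP => lt; apply: nF; split => //; exact: ltW.
  move=> /(le_trans eE); rewrite -leeBlDr// -EFinB.
  rewrite (_ : e * L ^+ 2 - _ = L * (e / 2 * L)); last by field.
  by rewrite EFinM lee_pmul2l// lte_fin.
have qF t : F t -> `|q (t, y)| <= C * s.
  move=> [tI leE]; have [f sf fE] := tensor_poly_snd t tq; rewrite fE.
  apply: (H f b L s (xsection E t)) => //.
  - exact: measurable_xsection.
  - by move=> u; rewrite /xsection/= inE => /EI[].
  - by move=> u; rewrite /xsection/= inE -fE; exact: qs.
have [f sf fE] := tensor_poly_fst y tq; rewrite fE -mulrA.
apply: (H f a L _ F) => //; first by move=> t [].
by move=> t /qF; rewrite fE.
Qed.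

Lemma tensor_poly_sup_le_L2 (R : realType) (p : nat) (e : R) : 0 < e ->
  exists2 C : R, 0 < C & forall (q : R * R -> R) (a b L : R) (S : set (mplane R)),
    tensor_poly p q -> 0 < L -> measurable S ->
    S `<=` `[a, a + L] `*` `[b, b + L] ->
    ((e * L ^+ 2)%:E <= @area R S)%E ->
    forall z, (`[a, a + L] `*` `[b, b + L]) z ->
    ((q z ^+ 2)%:E <= (C / L ^+ 2)%:E * L2sq S q)%E.
Proof.
move=> e0.
have [C C0 H] := tensor_poly_sup_of_large_set p (divr_gt0 e0 (ltr0Sn R 1)).
exists (8 * C ^+ 2 / e); first by rewrite divr_gt0// mulr_gt0// exprn_gt0.
move=> q a b L S tq L0 mS SI eS z zI.
have -> : 8 * C ^+ 2 / e / L ^+ 2 = 8 * C ^+ 2 / (e * L ^+ 2) by field; rewrite !gt_eqF.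
rewrite /L2sq /area; apply: sup_le_sq_integral => //.
- by apply: measurable_funTS; exact: tensor_poly_measurable tq.
- by rewrite mulr_gt0// exprn_gt0.
- move=> E' s mE' E'E leE' fE'.
  apply: (H q a b L s E') => //; first exact: subset_trans SI.
  by rewrite mulrAC.
Qed.

(** * Smooth curves trapped in a quadrant *)

(** The infimum of the set where [f] is nonnegative. The sign before [c] matters to the caller,
    which needs control of the path up to its first exit. *)
Lemma first_zero (R : realType) (f : R -> R) (a b : R) : a <= b -> continuous f ->
  f a < 0 -> 0 <= f b ->
  exists2 c, a <= c <= b & f c = 0 /\ forall s, a <= s < c -> f s < 0.
Proof.
move=> ab cf fa fb.
pose Z := [set s | a <= s <= b /\ 0 <= f s].
have Zb : Z b by split; rewrite ?ab ?lexx.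
have lbZ : lbound Z a by move=> s [/andP[]].
have hZ : has_inf Z by split; [exists b|exists a].
pose c := inf Z.
have ac : a <= c by apply: lb_le_inf => //; exists b.
have cb : c <= b by apply: ge_inf => //; exists a.
have ltc s : a <= s < c -> f s < 0.
  move=> /andP[as_ sc]; rewrite ltNge; apply/negP => fs.
  have : Z s by split => //; rewrite as_ (le_trans (ltW sc)).
  by move=> /(ge_inf (proj2 hZ)); rewrite leNgt sc.
have fc : 0 <= f c.
  rewrite leNgt; apply/negP => fc0.
  have /nbhs_ballP[eps /= eps0 H] : \forall s \near c, f s < 0.
    have := @cvgr_lt R R (nbhs c) _ f (f c) (cf c) 0 fc0. exact.
  have [z [zab fz] zc] := inf_adherent eps0 hZ.
  have cz : c <= z by apply: ge_inf => //; exists a.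
  have : f z < 0.
    apply: H; rewrite /ball/= distrC ger0_norm ?subr_ge0//.
    by rewrite ltrBlDl.
  by rewrite ltNge fz.
exists c; first by rewrite ac.
split => //.
have [d] : exists2 d, d \in `[a, c] & f d = 0.
  apply: IVT => //; first exact: continuous_subspaceT.
  by rewrite ge_min le_max fc (ltW fa) orbT.
rewrite in_itv/= => /andP[ad]; rewrite le_eqVlt => /predU1P[->//|dc] fd.
by have := ltc d; rewrite ad dc fd ltxx => /(_ isT).
Qed.

Lemma sumr_abs_continuous (R : realType) (c1 c2 : R -> R) (k : R) :
  continuous c1 -> continuous c2 -> continuous (fun s => `|c1 s| + `|c2 s| + k).
Proof.
move=> h1 h2 s; apply: cvgD; last exact: cvg_cst.
by apply: cvgD; apply: cvg_norm; [exact: h1|exact: h2].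
Qed.

(* With [e1, e2 = +-1], [0 <= e1 * u /\ 0 <= e2 * v] is a closed quadrant with apex 0. *)
Lemma trapped_path_hits_apex (R : realType) (c1 c2 : R -> R) (e1 e2 r T : R) :
  continuous c1 -> continuous c2 -> 0 < r -> 0 <= T -> `|e1| = 1 -> `|e2| = 1 ->
  (forall s, 0 <= s <= T -> `|c1 s| < r -> `|c2 s| < r ->
     [/\ 0 <= e1 * c1 s, 0 <= e2 * c2 s, `|c1 s| <= r / 4 & `|c2 s| <= r / 4] \/
     (e1 * c1 s <= 0 /\ e2 * c2 s <= 0)) ->
  0 <= e1 * c1 0 -> 0 <= e2 * c2 0 -> `|c1 0| < r -> `|c2 0| < r ->
  r <= `|c1 T| + `|c2 T| ->
  exists2 s, 0 <= s <= T & c1 s = 0 /\ c2 s = 0.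
Proof.
move=> cc1 cc2 r0 T0 ne1 ne2 H q1 q2 n1 n2 far.
have aE (e u : R) : `|e| = 1 -> `|u| = `|e * u| by move=> h; rewrite normrM h mul1r.
have z0 (e u : R) : `|e| = 1 -> e * u = 0 -> u = 0.
  by move=> /aE h h0; apply/eqP; rewrite -normr_eq0 h h0 normr0.
have both s : 0 <= e1 * c1 s -> 0 <= e2 * c2 s -> e1 * c1 s <= 0 -> e2 * c2 s <= 0 ->
    c1 s = 0 /\ c2 s = 0.
  by move=> h1 h2 h3 h4; split; [apply: (z0 e1)|apply: (z0 e2)] => //; lra.
(* The level [3 r / 4] lies between [r / 2], the largest 1-norm allowed in the first quadrant, and
   [r]. Up to the first time [s1] at which it is reached both coordinates stay below [r], so [H]
   applies, and at [s1] only the opposite quadrant is left. *)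
pose f s := `|c1 s| + `|c2 s| + - (3 / 4 * r).
have cf : continuous f by exact: sumr_abs_continuous.
have f0 : f 0 < 0.
  rewrite /f; have h0 : 0 <= (0 : R) <= T by rewrite lexx.
  have [[_ _ h3 h4]|[h3 h4]] := H 0 h0 n1 n2; first lra.
  by have [-> ->] := both 0 q1 q2 h3 h4; rewrite normr0; lra.
have fT : 0 <= f T by rewrite /f; lra.
have [s1 /andP[s10 s1T] [fs1 lts1]] := first_zero T0 cf f0 fT.
have le s : 0 <= s <= s1 -> `|c1 s| + `|c2 s| <= 3 / 4 * r.
  move=> /andP[s0 ss1]; have : f s <= 0.
    move: ss1; rewrite le_eqVlt => /predU1P[->|ss1]; first by rewrite fs1.
    by apply/ltW/lts1; rewrite s0.
  by rewrite /f; lra.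
have near s : 0 <= s <= s1 -> `|c1 s| < r /\ `|c2 s| < r.
  by move=> /le; have := normr_ge0 (c1 s); have := normr_ge0 (c2 s); lra.
(* [psi] is nonnegative at 0 and nonpositive at [s1]. At a zero of [psi] the two summands have the
   same sign in either quadrant, so both vanish. *)
pose psi s := e1 * c1 s + e2 * c2 s.
have cpsi : continuous psi.
  by move=> s; apply: cvgD; apply: cvgM; [exact: cvg_cst|exact: cc1|exact: cvg_cst|exact: cc2].
have [m1 m2] : `|c1 s1| < r /\ `|c2 s1| < r by apply: near; rewrite s10 lexx.
have s1I : 0 <= s1 <= T by rewrite s10.
have [[_ _ l1 l2]|[k1 k2]] := H s1 s1I m1 m2.
  by move: fs1; rewrite /f; lra.
have [d +  psid] : exists2 d, d \in `[0, s1] & psi d = 0.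
  apply: IVT => //; first exact: continuous_subspaceT.
  by rewrite ge_min le_max /psi; apply/andP; split; apply/orP; [right|left]; lra.
rewrite in_itv/= => /andP[d0 ds1].
have dI : 0 <= d <= T by rewrite d0 (le_trans ds1).
have [k3 k4] : `|c1 d| < r /\ `|c2 d| < r by apply: near; rewrite d0.
exists d => //; move: psid; rewrite /psi => psid.
have [[h1 h2 _ _]|[h1 h2]] := H d dI k3 k4; split.
- by apply: (z0 e1) => //; lra.
- by apply: (z0 e2) => //; lra.
- by apply: (z0 e1) => //; lra.
- by apply: (z0 e2) => //; lra.
Qed.

Lemma derivable_continuous (R : realType) (f : R -> R) :
  (forall t, derivable f t 1) -> continuous f.
Proof. by move=> df t; apply: differentiable_continuous; apply/derivable1_diffP. Qed.

Lemma mean_value (R : realType) (f : R -> R) (s t : R) : s < t ->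
  (forall t, derivable f t 1) ->
  exists2 c, s < c < t & f t - f s = derive1 f c * (t - s).
Proof.
move=> st df.
have [|c] := @MVT R f (derive1 f) s t st _ (continuous_subspaceT (derivable_continuous df)).
  by move=> x _; rewrite derive1E; apply: DeriveDef.
by rewrite in_itv/=; exists c.
Qed.

Lemma smooth_param_derivable (R : realType) (a b : R -> R) :
  smooth_param a b ->
  (forall t, derivable a t 1) /\ (forall t, derivable b t 1) /\
  (forall t, derivable (derive1 a) t 1) /\ (forall t, derivable (derive1 b) t 1) /\
  (forall t, derivable (derive1 (derive1 a)) t 1) /\
  (forall t, derivable (derive1 (derive1 b)) t 1).
Proof.
move=> [sm _].
have d0 (f : R -> R) : derive1n 0 f = f by [].
have d1 (f : R -> R) : derive1n 1 f = derive1 f by rewrite derive1nS d0.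
have d2 (f : R -> R) : derive1n 2 f = derive1 (derive1 f) by rewrite derive1nS d1.
split=> [t|]; first by rewrite -(d0 a); exact: (proj1 (sm 0%N t)).
split=> [t|]; first by rewrite -(d0 b); exact: (proj2 (sm 0%N t)).
split=> [t|]; first by rewrite -d1; exact: (proj1 (sm 1%N t)).
split=> [t|]; first by rewrite -d1; exact: (proj2 (sm 1%N t)).
by split=> t; rewrite -d2; [exact: (proj1 (sm 2%N t))|exact: (proj2 (sm 2%N t))].
Qed.

(** By compactness the speed is at least [m] and the second derivatives at most [M] on [[0, 1]]. At
    [s] one component of the velocity is at least [m / 2], and it stays above [m / 4] for a time
    [m / (4 M)]. The linear lower bound also measures how fast a trapped curve must get away. *)
Lemma smooth_param_locally_injective (R : realType) (a b : R -> R) :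
  smooth_param a b ->
  exists mu d : R, [/\ 0 < mu, 0 < d & forall s t, 0 <= s <= 1 -> 0 <= t <= 1 ->
    `|t - s| <= d -> mu * `|t - s| <= `|a t - a s| + `|b t - b s|].
Proof.
move=> sp; have [sm reg] := sp.
have [da [db [da1 [db1 [da2 db2]]]]] := smooth_param_derivable sp.
pose f t := `|derive1 a t| + `|derive1 b t| + 0.
have cf : continuous f := sumr_abs_continuous (derivable_continuous da1) (derivable_continuous db1).
pose g t := `|derive1 (derive1 a) t| + `|derive1 (derive1 b) t| + 0.
have cg : continuous g := sumr_abs_continuous (derivable_continuous da2) (derivable_continuous db2).
have [t0 t0I minf] := EVT_min (@ler01 R) (continuous_subspaceT cf).
have [t1 t1I maxg] := EVT_max (@ler01 R) (continuous_subspaceT cg).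
have [m m0 fm] : exists2 m, 0 < m &
    forall t, 0 <= t <= 1 -> m <= `|derive1 a t| + `|derive1 b t|.
  exists (f t0); last first.
    by move=> t tI; have := minf t; rewrite in_itv/= tI => /(_ isT); rewrite {2}/f addr0.
  rewrite lt_neqAle eq_sym; apply/andP; split; last by rewrite /f addr0 addr_ge0.
  apply/eqP => ft0; have : (derive1 a t0, derive1 b t0) <> (0, 0).
    by apply: reg; move: t0I; rewrite in_itv.
  apply; move/eqP: ft0; rewrite /f addr0 paddr_eq0//.
  by move=> /andP[/eqP/normr0_eq0 -> /eqP/normr0_eq0 ->].
have [M M0 gM] : exists2 M, 0 < M &
    forall t, 0 <= t <= 1 -> `|derive1 (derive1 a) t| + `|derive1 (derive1 b) t| <= M.
  exists (g t1 + 1); first by rewrite /g addr0 ltr_wpDl// addr_ge0.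
  move=> t tI; have := maxg t; rewrite in_itv/= tI => /(_ isT); rewrite {1}/g addr0.
  by move=> /le_trans; apply; rewrite lerDl.
clear f cf minf t0I g cg maxg t1I.
exists (m / 4), (m / (4 * M)); split; [by rewrite divr_gt0|by rewrite divr_gt0// mulr_gt0|].
have lip (h : R -> R) (s c : R) : (forall t, derivable h t 1) ->
    (forall t, 0 <= t <= 1 -> `|derive1 h t| <= M) -> 0 <= s -> s < c -> c <= 1 ->
    c - s <= m / (4 * M) -> `|h c - h s| <= m / 4.
  move=> dh hM s0 sc c1 cs; have [x /andP[sx xc] ->] := mean_value sc dh.
  rewrite normrM (@le_trans _ _ (M * (m / (4 * M))))//.
    apply: ler_pM => //; last by rewrite gtr0_norm// subr_gt0.
    by apply: hM; rewrite (le_trans s0 (ltW sx)) (le_trans (ltW xc)).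
  by rewrite le_eqVlt; apply/orP; left; apply/eqP; field; rewrite gt_eqF.
have aM t : 0 <= t <= 1 -> `|derive1 (derive1 a) t| <= M.
  by move=> /gM; apply: le_trans; rewrite lerDl.
have bM t : 0 <= t <= 1 -> `|derive1 (derive1 b) t| <= M.
  by move=> /gM; apply: le_trans; rewrite lerDr.
have grow (h : R -> R) (s t : R) : (forall t, derivable h t 1) ->
    (forall t, derivable (derive1 h) t 1) ->
    (forall t, 0 <= t <= 1 -> `|derive1 (derive1 h) t| <= M) ->
    0 <= s -> s < t -> t <= 1 -> t - s <= m / (4 * M) ->
    m / 2 <= `|derive1 h s| -> m / 4 * (t - s) <= `|h t - h s|.
  move=> dh dh1 hM s0 st t1' ts hs.
  have [x /andP[sx xt] ->] := mean_value st dh.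
  rewrite normrM (gtr0_norm (_ : 0 < t - s)) ?subr_gt0//.
  rewrite ler_pM2r ?subr_gt0//.
  have lx : `|derive1 h x - derive1 h s| <= m / 4.
    by apply: lip => //; [exact: le_trans (ltW xt) _|lra].
  have := ler_normB (derive1 h x) (derive1 h x - derive1 h s).
  rewrite opprB addrC subrK; move: lx hs; move: `|_| `|_| `|_| => A B C; lra.
move=> s t.
wlog st : s t / s <= t => [H sI tI ts|].
  have [st|/ltW ts'] := leP s t; first exact: H.
  rewrite distrC (distrC (a t)) (distrC (b t)).
  by apply: H => //; rewrite distrC.
move=> /andP[s0 s1] /andP[t0' t1']; rewrite (ger0_norm (_ : 0 <= t - s)) ?subr_ge0// => ts.
move: st; rewrite le_eqVlt => /predU1P[->|st].
  by rewrite subrr mulr0 addr_ge0.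
have [la|lb] := leP (m / 2) `|derive1 a s|.
  by rewrite (le_trans (grow a s t da da1 aM s0 st t1' ts la))// lerDl.
have lb' : m / 2 <= `|derive1 b s|.
  have := fm s; rewrite s0 s1 => /(_ isT).
  by move: lb; move: `|_| `|_| => A B; lra.
by rewrite (le_trans (grow b s t db db1 bM s0 st t1' ts lb'))// lerDr.
Qed.

(* [D.2] is a slope of [v] over [u] if [D.1] holds, and of [u] over [v] otherwise. *)
Definition near_line (R : realType) (w : R) (D : bool * R) (u v : R) : Prop :=
  if D.1 then `|v - D.2 * u| <= w * `|u| else `|u - D.2 * v| <= w * `|v|.

(** The double cone is invariant under scaling; this carries the condition from a boundary point on
    a ray to the other points of that ray. *)
Lemma near_lineZ (R : realType) (w : R) (D : bool * R) (u v k : R) : k != 0 ->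
  near_line w D (k * u) (k * v) -> near_line w D u v.
Proof.
move=> k0; have kk : 0 < `|k| by rewrite normr_gt0.
rewrite /near_line; case: D.1 => /=; rewrite (mulrCA _ k) -mulrBr !normrM.
  by rewrite mulrCA ler_pM2l.
by rewrite mulrCA ler_pM2l.
Qed.

(** All chords near [e] are nearly parallel to the tangent, not only those starting at [e]: the apex
    will be met at some nearby parameter. The derivative [k] of [g - q f] vanishes at [e], so nearby
    [|k| <= w |f'(e)| / 2] and [|f'| >= |f'(e)| / 2]; the mean value theorem is applied to [f] and
    to [g - q f] separately. *)
Lemma differentiable_pair_near_line (R : realType) (f g : R -> R) (e w : R) :
  (forall t, derivable f t 1) -> (forall t, derivable (derive1 f) t 1) ->
  (forall t, derivable g t 1) -> (forall t, derivable (derive1 g) t 1) ->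
  derive1 f e != 0 -> 0 < w ->
  exists q eta : R, 0 < eta /\ forall s t, `|s - e| < eta -> `|t - e| < eta ->
    `|(g t - g s) - q * (f t - f s)| <= w * `|f t - f s|.
Proof.
move=> df df1 dg dg1 f0 w0.
pose q := derive1 g e / derive1 f e; exists q.
have F0 : 0 < `|derive1 f e| by rewrite normr_gt0.
have c1 := derivable_continuous df1.
have c2 := derivable_continuous dg1.
pose k t := derive1 g t - q * derive1 f t.
have ck : continuous k.
  by move=> t; apply: cvgB; [exact: c2|apply: cvgM; [exact: cvg_cst|exact: c1]].
have ke : k e = 0 by rewrite /k /q divfK// subrr.
have w2 : 0 < w * `|derive1 f e| / 2 by rewrite divr_gt0// mulr_gt0.
have n1 := @cvgr_dist_lt R R R (nbhs e) _ (derive1 f) _ (c1 e) _ (divr_gt0 F0 (ltr0Sn R 1)).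
have n2 := @cvgr_dist_lt R R R (nbhs e) _ k _ (ck e) _ w2.
have nn : \forall t \near e, `|derive1 f e - derive1 f t| < `|derive1 f e| / 2 /\
    `|k e - k t| < w * `|derive1 f e| / 2.
  exact: filterI (n1 _) (n2 _).
move/nbhs_ballP: nn => [eta /= eta0 H].
exists eta; split=> [|s t]; first by [].
pose K : R -> R := g - q *: f.
have KE x : K x = g x - q * f x by [].
have dk x : derivable K x 1.
  by apply: derivableB; [exact: dg|apply: derivableZ; exact: df].
have dkE x : derive1 K x = k x.
  rewrite derive1E deriveB; [|exact: dg|by apply: derivableZ; exact: df].
  by rewrite deriveZ; [rewrite /k !derive1E|exact: df].
wlog st : s t / s <= t => [W sI tI|].
  have [st|/ltW ts'] := leP s t; first exact: W.
  have := W t s ts' tI sI; rewrite (distrC (f s)) -[X in X <= _]normrN.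
  by have -> : - (g s - g t - q * (f s - f t)) = g t - g s - q * (f t - f s) by ring.
move=> sI tI; move: st; rewrite le_eqVlt => /predU1P[->|st].
  by rewrite !subrr mulr0 subrr normr0 mulr0.
have inb x : s < x < t -> ball e eta x.
  move=> /andP[sx xt]; rewrite /ball/=; move: sI tI; rewrite !ltr_norml => /andP[? ?] /andP[? ?].
  by apply/andP; split; lra.
have [x /inb xI fE] := mean_value st df.
have [y /inb yI kE] := mean_value st dk.
have -> : g t - g s - q * (f t - f s) = K t - K s by rewrite !KE; ring.
rewrite kE fE dkE !normrM mulrA ler_wpM2r//.
have [h1 _] := H _ xI; have [_] := H _ yI; rewrite ke sub0r normrN => h2.
have := ler_normB (derive1 f e) (derive1 f e - derive1 f x).
have := ler_normD (derive1 f x) (derive1 f e - derive1 f x).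
rewrite addrC subrK => h3 _.
have h4 : `|derive1 f e| / 2 <= `|derive1 f x| by lra.
apply: (le_trans (ltW h2)); rewrite -mulrA ler_wpM2l//; lra.
Qed.

Lemma smooth_param_near_line (R : realType) (a b : R -> R) (e w : R) :
  smooth_param a b -> 0 <= e <= 1 -> 0 < w ->
  exists (D : bool * R) (eta : R), 0 < eta /\
    forall s t, `|s - e| < eta -> `|t - e| < eta ->
      near_line w D (a t - a s) (b t - b s).
Proof.
move=> sp eI w0; have [_ reg] := sp.
have [da [db [da1 [db1 _]]]] := smooth_param_derivable sp.
have [ae|ae] := eqVneq (derive1 a e) 0; last first.
  have [q [eta [eta0 H]]] := differentiable_pair_near_line da da1 db db1 ae w0.
  by exists (true, q), eta.
have be : derive1 b e != 0.
  by apply/eqP => be; apply: (reg e eI); rewrite ae be.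
have [q [eta [eta0 H]]] := differentiable_pair_near_line db db1 da da1 be w0.
by exists (false, q), eta.
Qed.

(** The two adjacent quadrants are empty off the axes and the first one is empty beyond [r / 4], so
    a path in [S] that starts in the first quadrant can get far away only through [P]. The opposite
    quadrant is left free: it is where the share of the patch lies. *)
Definition quadrant_trap (R : realType) (e1 e2 r : R) (S : set (R * R)) (P : R * R) : Prop :=
  forall x, S x -> `|x.1 - P.1| < r -> `|x.2 - P.2| < r ->
    [/\ 0 <= e1 * (x.1 - P.1), 0 <= e2 * (x.2 - P.2),
        `|x.1 - P.1| <= r / 4 & `|x.2 - P.2| <= r / 4] \/
    (e1 * (x.1 - P.1) <= 0 /\ e2 * (x.2 - P.2) <= 0).

Lemma continuous_reparam (R : realType) (a : R -> R) (t k P : R) :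
  continuous a -> continuous (fun s => a (t + k * s) - P).
Proof.
move=> ca s; apply: cvgB; last exact: cvg_cst.
apply: (@continuous_comp _ _ _ (fun s => t + k * s) a); last exact: ca.
by apply: cvgD; [exact: cvg_cst|apply: cvgM; [exact: cvg_cst|exact: cvg_id]].
Qed.

(** Followed for a time [T] in either direction, if its parameter interval allows it, the curve gets
    away from [P] and so has passed through [P]. Both directions together contradict local
    injectivity. Hence [t] is within [T] of an end, the curve meets [P] at a parameter close to the
    same end, and the chord between the two is close to the tangent there. *)
Lemma trapped_curve_near_line (R : realType) (a b : R -> R) (w : R) :
  smooth_param a b -> 0 < w ->
  exists (rho : R) (D : bool -> bool * R), 0 < rho /\
  forall (r : R) (P : R * R) (e1 e2 : R), 0 < r <= rho -> `|e1| = 1 -> `|e2| = 1 ->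
    quadrant_trap e1 e2 r [set (a t, b t) | t in `[0, 1]] P ->
  forall t, 0 <= t <= 1 -> 0 <= e1 * (a t - P.1) -> 0 <= e2 * (b t - P.2) ->
    (a t, b t) <> P -> `|a t - P.1| < r -> `|b t - P.2| < r ->
    exists i, near_line w (D i) (a t - P.1) (b t - P.2).
Proof.
move=> sp w0.
have [da [db _]] := smooth_param_derivable sp.
have ca := derivable_continuous da; have cb := derivable_continuous db.
have [mu [d [mu0 d0 inj]]] := smooth_param_locally_injective sp.
have I0 : 0 <= (0 : R) <= 1 by rewrite lexx ler01.
have I1 : 0 <= (1 : R) <= 1 by rewrite lexx ler01.
have [D0 [h0 [h00 H0]]] := smooth_param_near_line sp I0 w0.
have [D1 [h1 [h10 H1]]] := smooth_param_near_line sp I1 w0.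
pose m := Num.min (Num.min d 1) (Num.min h0 h1).
have m0 : 0 < m by rewrite !lt_min d0 ltr01 h00.
have md : m <= d by rewrite !ge_min lexx.
have m1 : m <= 1 by rewrite !ge_min lexx !orbT.
have mh0 : m <= h0 by rewrite !ge_min lexx !orbT.
have mh1 : m <= h1 by rewrite !ge_min lexx !orbT.
clearbody m.
(* This bound on [r] makes [4 T <= m] for [T = 3 r / mu]. After time [T] the curve is at 1-distance
   at least [mu T = 3 r] from its start, which is within [2 r] of [P], hence at least [r] from [P].
   The index [false] stands for the end tangent at 0 and [true] for the one at 1. *)
exists (mu * m / 12), (fun i => if i then D1 else D0); split.
  by rewrite divr_gt0// mulr_gt0.
move=> r [P1 P2] e1 e2 /andP[r0 rrho] ne1 ne2 trap t /andP[t0 t1] /= q1 q2 neP n1 n2.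
pose T := 3 * r / mu.
have T0 : 0 < T by rewrite divr_gt0// mulr_gt0.
have muT : mu * T = 3 * r by rewrite /T mulrC divfK// gt_eqF.
have Tm : 4 * T <= m by rewrite -(ler_pM2l mu0) mulrCA muT; lra.
clearbody T.
have hit (k : R) : `|k| = 1 -> 0 <= t + k * T <= 1 ->
    exists s, [/\ 0 < s <= T, a (t + k * s) = P1 & b (t + k * s) = P2].
  move=> nk /andP[k0 k1].
  have kI s : 0 <= s <= T -> 0 <= t + k * s <= 1.
    move=> /andP[s0 sT].
    have [k00|k00] := leP 0 k.
      have k01 : k = 1 by rewrite -nk ger0_norm.
      by move: k0 k1; rewrite k01 !mul1r => k0 k1; apply/andP; split; lra.
    have k01 : k = -1 by rewrite -nk ltr0_norm// opprK.
    by move: k0 k1; rewrite k01 !mulN1r => k0 k1; apply/andP; split; lra.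
  have T00 := ltW T0.
  have far : r <= `|a (t + k * T) - P1| + `|b (t + k * T) - P2|.
    have := inj t (t + k * T); rewrite t0 t1 k0 k1 => /(_ isT isT).
    rewrite addrAC subrr add0r normrM nk mul1r (gtr0_norm T0).
    have -> : T <= d by lra.
    move=> /(_ isT); rewrite muT => h.
    have := ler_distD P1 (a (t + k * T)) (a t); have := ler_distD P2 (b (t + k * T)) (b t).
    rewrite (distrC P1) (distrC P2).
    move: n1 n2 h; move: `|_| `|_| `|_| `|_| `|_| `|_| => x1 x2 x3 x4 x5 x6; lra.
  have c0 : t + k * 0 = t by rewrite mulr0 addr0.
  have [s sI [sa sb]] : exists2 s, 0 <= s <= T & a (t + k * s) - P1 = 0 /\ b (t + k * s) - P2 = 0.
    apply: (@trapped_path_hits_apex R (fun s => a (t + k * s) - P1) (fun s => b (t + k * s) - P2)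
      e1 e2 r T (@continuous_reparam R a t k P1 ca) (@continuous_reparam R b t k P2 cb) r0 T00 ne1 ne2);
      rewrite ?c0//.
    move=> s sI s1 s2; apply: (trap (a (t + k * s), b (t + k * s))) => //=.
    by exists (t + k * s) => //=; rewrite in_itv/= kI.
  move/eqP: sa; move/eqP: sb; rewrite !subr_eq0 => /eqP sb /eqP sa.
  exists s; split => //; move: sI => /andP[s0 ->]; rewrite andbT lt_neqAle s0 andbT.
  by apply/eqP => s00; apply: neP; rewrite -sa -sb -s00 mulr0 addr0.
have n1N : `|(-1 : R)| = 1 by rewrite normrN normr1.
have n11 : `|(1 : R)| = 1 by rewrite normr1.
have [tT|tT] := ltP t T.
  have [|s [/andP[s0 sT] sa sb]] := hit 1 n11; first by rewrite mul1r; apply/andP; split; lra.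
  exists false; rewrite -sa -sb mul1r; apply: H0; rewrite subr0 ger0_norm; lra.
have [|s [/andP[s0 sT] sa sb]] := hit (-1) n1N.
  by rewrite mulN1r; apply/andP; split; lra.
have [t1T|t1T] := ltP 1 (t + T).
  exists true; rewrite -sa -sb mulN1r; apply: H1; rewrite ler0_norm; lra.
have [|s' [/andP[s'0 s'T] sa' sb']] := hit 1 n11.
  by rewrite mul1r; apply/andP; split; lra.
(* Two passages through [P] at parameters that differ by [s + s'], positive and at most
   [2 T <= d]. *)
have := inj (t + -1 * s) (t + 1 * s').
rewrite sa sb sa' sb' !subrr normr0 addr0.
have -> : t + 1 * s' - (t + -1 * s) = s' + s by ring.
rewrite gtr0_norm; last lra.
have -> : 0 <= t + -1 * s <= 1 by apply/andP; split; lra.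
have -> : 0 <= t + 1 * s' <= 1 by apply/andP; split; lra.
have -> : s' + s <= d by lra.
by move=> /(_ isT isT isT); rewrite leNgt mulr_gt0// addr_gt0.
Qed.

(** * Strips and the confinement of the patch *)

Lemma cvg_segment (R : realType) (x v : R * R) :
  continuous (fun s : R => (x.1 + s * v.1, x.2 + s * v.2)).
Proof.
move=> s.
have h1 : (x.1 + t * v.1) @[t --> s] --> x.1 + s * v.1.
  by apply: cvgD; [exact: cvg_cst|apply: cvgM; [exact: cvg_id|exact: cvg_cst]].
have h2 : (x.2 + t * v.2) @[t --> s] --> x.2 + s * v.2.
  by apply: cvgD; [exact: cvg_cst|apply: cvgM; [exact: cvg_id|exact: cvg_cst]].
exact: (cvg_pair h1 h2).
Qed.

(** The supremum of the parameters with image in [S] gives a point that is adherent to [S] and not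
    interior, whether [S] is open, closed or neither. *)
Lemma segment_meets_boundary (R : realType) (S : set (R * R)) (x v : R * R) (T : R) :
  0 <= T -> S x -> ~ S (x.1 + T * v.1, x.2 + T * v.2) ->
  exists2 s, 0 <= s <= T & boundary S (x.1 + s * v.1, x.2 + s * v.2).
Proof.
move=> T0 Sx nS; pose f s := (x.1 + s * v.1, x.2 + s * v.2).
have cf : continuous f by exact: cvg_segment.
have f0 : f 0 = x by rewrite /f !mul0r !addr0; case: (x).
pose Z := [set s | 0 <= s <= T /\ S (f s)].
have Z0 : Z 0 by split; rewrite ?lexx ?T0// f0.
have ubZ : ubound Z T by move=> s [/andP[]].
have hZ : has_sup Z by split; [exists 0|exists T].
have bZ : has_ubound Z by exists T.
pose c := sup Z.
have c0 : 0 <= c by exact: ub_le_sup.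
have cT : c <= T by apply: ge_sup => //; exists 0.
exists c; first by rewrite c0.
have ball_f U : nbhs (f c) U -> exists2 e : R, 0 < e & forall s, `|c - s| < e -> U (f s).
  by move=> /cf /nbhs_ballP[e e0 H]; exists e.
split.
  move=> U /ball_f[e e0 H].
  have [z [zI Sz] cz] := sup_adherent e0 hZ.
  exists (f z); split => //; apply: H.
  have zc : z <= c by apply: ub_le_sup.
  by rewrite ger0_norm ?subr_ge0// ltrBlDl -ltrBlDr.
move=> /ball_f[e e0 H].
have Sc : S (f c) by apply: H; rewrite subrr normr0.
have ltcT : c < T.
  by rewrite lt_neqAle cT andbT; apply/eqP => cE; apply: nS; rewrite -cE.
pose s := Num.min T (c + e / 2).
have cs : c < s by rewrite lt_min ltcT ltrDl divr_gt0.
have : s <= c.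
  apply: ub_le_sup => //; split.
    by rewrite (le_trans c0 (ltW cs)) ge_min lexx.
  apply: H; rewrite ltr0_norm ?subr_lt0// opprB ltrBlDl.
  by apply: (@le_lt_trans _ _ (c + e / 2)); [rewrite ge_min lexx orbT|lra].
by rewrite leNgt cs.
Qed.

Lemma measure_le_sum d (T : measurableType d) (R : realType)
    (mu : {measure set T -> \bar R}) (I : eqType) (s : seq I) (F : I -> set T) (A : set T) :
  measurable A -> (forall i, measurable (F i)) ->
  (forall x, A x -> exists2 i, i \in s & F i x) ->
  (mu A <= \sum_(i <- s) mu (F i))%E.
Proof.
move=> + mF; elim: s A => [|i s IH] A mA AF.
  have -> : A = set0 by rewrite -subset0 => x /AF[].
  by rewrite measure0 big_nil.
rewrite big_cons; apply: (@le_trans _ _ (mu (F i) + mu (A `\` F i))%E).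
  apply: le_trans (measureU2 _ _ _) => //; last exact: measurableD.
  apply: le_measure; rewrite ?inE//.
    by apply: measurableU => //; exact: measurableD.
  by move=> x Ax; have [Fx|nFx] := pselect (F i x); [left|right].
rewrite leeD2l//; apply: IH; first exact: measurableD.
move=> x [/AF[j]]; rewrite inE => /predU1P[->//|js] Fj _; by exists j.
Qed.

Definition box (R : realType) (x : R * R) (r : R) : set (R * R) :=
  `[x.1 - r, x.1 + r] `*` `[x.2 - r, x.2 + r].

Lemma boxE (R : realType) (x z : R * R) (r : R) :
  box x r z <-> `|z.1 - x.1| <= r /\ `|z.2 - x.2| <= r.
Proof.
rewrite /box /setX/= !in_itv/= !ler_distl; split; first by [].
by [].
Qed.

Lemma measurable_box (R : realType) (x : R * R) (r : R) :
  measurable (box x r : set (mplane R)).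
Proof. by apply: measurableX; exact: measurable_itv. Qed.

(** The cone [near_line] cut at sup-distance [d] and widened by replacing [w |u|] with [w d]: it
    lies in a parallelogram whose sections along one axis all have length [2 w d]. *)
Definition strip (R : realType) (w d : R) (D : bool * R) (P : R * R) : set (mplane R) :=
  [set x | [/\ `|x.1 - P.1| <= d, `|x.2 - P.2| <= d &
     (if D.1 then `|(x.2 - P.2) - D.2 * (x.1 - P.1)| <= w * d
      else `|(x.1 - P.1) - D.2 * (x.2 - P.2)| <= w * d)]].

Lemma measurable_normr_le (R : realType) (f : mplane R -> R) (k : R) :
  measurable_fun setT f -> measurable [set x | `|f x| <= k].
Proof.
move=> mf; have -> : [set x | `|f x| <= k] = setT `&` (fun x => `|f x|) @^-1` `]-oo, k]%classic.
  by rewrite setTI; apply/seteqP; split => x /=; rewrite in_itv/=.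
have mn : measurable_fun setT (fun x => `|f x|) by exact: measurableT_comp.
exact: (mn _ _ (measurable_itv _)).
Qed.

Lemma measurable_strip (R : realType) (w d : R) D (P : R * R) : measurable (strip w d D P).
Proof.
have m1 : measurable_fun setT (fun x : mplane R => x.1 - P.1).
  by apply: measurable_funB => //; exact: measurable_fst.
have m2 : measurable_fun setT (fun x : mplane R => x.2 - P.2).
  by apply: measurable_funB => //; exact: measurable_snd.
case: D => D q; rewrite /strip/=.
have -> : [set x : mplane R | [/\ `|x.1 - P.1| <= d, `|x.2 - P.2| <= d &
     (if D then `|(x.2 - P.2) - q * (x.1 - P.1)| <= w * d
      else `|(x.1 - P.1) - q * (x.2 - P.2)| <= w * d)]] =
   ([set x | `|x.1 - P.1| <= d] `&` [set x | `|x.2 - P.2| <= d]) `&`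
   [set x | `|if D then (x.2 - P.2) - q * (x.1 - P.1) else (x.1 - P.1) - q * (x.2 - P.2)| <= w * d].
  by apply/seteqP; split => x /=; case: D; do ?[case=> h1 h2 h3]; do ?[case=> -[h1 h2] h3].
apply: measurableI; first by apply: measurableI; exact: measurable_normr_le.
apply: measurable_normr_le; case: D; apply: measurable_funB => //; exact: measurable_funM.
Qed.

Lemma area_swap (R : realType) (E : set (mplane R)) :
  measurable E -> @area R E = @area R [set x | E (x.2, x.1)].
Proof.
move=> mE; rewrite [LHS](@product_measure_unique _ _ _ _ _ _ _
  (@lebesgue_measure R \x^ @lebesgue_measure R)%E)//; last first.
  by move=> A B mA mB; exact: product_measure2E.
Qed.

Lemma area_strip (R : realType) (w d : R) D (P : R * R) : 0 <= w -> 0 <= d ->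
  (@area R (strip w d D P) <= (4 * w * d ^+ 2)%:E)%E.
Proof.
move=> w0 d0.
wlog D1 : D P / D.1 = true => [H|].
  case: D => -[] q; first exact: (H (true, q) P).
  rewrite area_swap; last exact: measurable_strip.
  have -> : [set x : mplane R | strip w d (false, q) P (x.2, x.1)] = strip w d (true, q) (P.2, P.1).
    by apply/seteqP; split => x [h1 h2 h3]; split.
  exact: (H (true, q) (P.2, P.1)).
have wd0 : 0 <= w * d by rewrite mulr_ge0.
(* Every section is short, so the exceptional set is empty; what remains is the section length
   [2 w d] times the base length [2 d]. *)
have -> : (4 * w * d ^+ 2)%:E = ((w * d *+ 2)%:E * @lebesgue_measure R set0 + (w * d *+ 2 * (d *+ 2))%:E)%E.
  by rewrite measure0 mule0 add0e; congr EFin; rewrite !mulr2n; ring.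
have sec x : (lebesgue_measure (xsection (strip w d D P) x) <= (w * d *+ 2)%:E)%E.
  pose c := P.2 + D.2 * (x - P.1).
  have -> : (w * d *+ 2)%:E = @lebesgue_measure R `[c - w * d, c + w * d].
    rewrite lebesgue_measure_segment; last lra.
    by congr EFin; rewrite mulr2n; ring.
  apply: le_measure; rewrite ?inE.
  - by apply: measurable_xsection; exact: measurable_strip.
  - exact: measurable_itv.
  - move=> y; rewrite /xsection /strip/= inE/= D1 in_itv/= => -[_ _].
    rewrite ler_norml => /andP[h1 h2]; apply/andP; rewrite /c; split; lra.
apply: (@area_le_sections _ (P.1 - d)) => //.
- exact: measurable_strip.
- by rewrite mulrn_wge0.
- by rewrite mulrn_wge0.
- by rewrite mulrn_wge0.
- move=> z [h1 _ _]; rewrite in_itv/=; move: h1; rewrite ler_norml => /andP[h1 h2].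
  by apply/andP; rewrite mulr2n; split; lra.
Qed.

Lemma near_line_strip (R : realType) (w d : R) D (P x : R * R) : 0 <= w ->
  near_line w D (x.1 - P.1) (x.2 - P.2) -> `|x.1 - P.1| <= d -> `|x.2 - P.2| <= d ->
  strip w d D P x.
Proof.
move=> w0; rewrite /near_line /strip => + h1 h2; split => //=; case: D.1 H => H.
  by apply: (le_trans H); rewrite ler_wpM2l.
by apply: (le_trans H); rewrite ler_wpM2l.
Qed.

Lemma finite_pos_lower_bound (R : realType) (I : finType) (f : I -> R) :
  (forall i, 0 < f i) -> exists2 m : R, 0 < m & forall i, m <= f i.
Proof.
(* The default value 1 keeps the minimum positive when [I] is empty, as for a boundary without
   curves. *)
move=> f0; exists (\big[Num.min/1]_i f i); last by move=> i; exact: bigmin_le_cond.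
by apply: lt_bigmin.
Qed.

(* A radius-[r] quadrant at [P] that carries part of [S] without any of it
   leaving through the two neighbouring quadrants, nor beyond radius [r / 4],
   would confine [S] there to thin cones around the end tangents of the
   boundary curves, against the density bound. *)
Lemma quadrant_trap_free (R : realType) (S : set (R * R)) (c1 : R) :
  measurable (S : set (mplane R)) -> finitely_many_smooth_curves (boundary S) ->
  0 < c1 ->
  (forall x r, S x -> 0 < r <= 1 -> ((c1 * r ^+ 2)%:E <= @area R (S `&` box x r))%E) ->
  exists2 rho : R, 0 < rho & forall r (P : R * R) (e1 e2 : R), 0 < r <= rho ->
    `|e1| = 1 -> `|e2| = 1 -> quadrant_trap e1 e2 r (closure S) P ->
    forall z, S z -> 0 <= e1 * (z.1 - P.1) -> 0 <= e2 * (z.2 - P.2) ->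
      `|z.1 - P.1| < r -> `|z.2 - P.2| < r -> z = P.
Proof.
move=> mS [m [G [smG bE]]] c10 dens.
have m1 : 0 < (m.+1%:R : R) by rewrite ltr0n.
(* There will be [2 m] strips of area at most [4 w (2 n)^2], in all [32 m w n^2], which must stay
   below the density bound [c1 (n / 2)^2]. Taking [m + 1] makes the inequality strict and covers
   [m = 0]. *)
pose w := c1 / (128 * m.+1%:R).
have w0 : 0 < w by rewrite divr_gt0// mulr_gt0.
have loc (i : 'I_m) : exists t : R * (bool -> bool * R), 0 < t.1 /\
  forall (r : R) (P : R * R) (e1 e2 : R), 0 < r <= t.1 -> `|e1| = 1 -> `|e2| = 1 ->
    quadrant_trap e1 e2 r (G i) P ->
  forall y, G i y -> 0 <= e1 * (y.1 - P.1) -> 0 <= e2 * (y.2 - P.2) ->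
    y <> P -> `|y.1 - P.1| < r -> `|y.2 - P.2| < r ->
    exists k, near_line w (t.2 k) (y.1 - P.1) (y.2 - P.2).
  have [a [b [sp GE]]] := smG i.
  have [rho [D [rho0 H]]] := trapped_curve_near_line sp w0.
  exists (rho, D); split => // r P e1 e2 rI ne1 ne2; rewrite GE => trap y [t + <-] /=.
  by move=> tI q1 q2 neP n1 n2; exact: (H r P e1 e2 rI ne1 ne2 trap t tI).
have [t tH] := choice loc.
have [rho0 rho00 rhoH] : exists2 m : R, 0 < m & forall i, m <= (t i).1.
  by apply: finite_pos_lower_bound => i; have [] := tH i.
exists (Num.min rho0 1); first by rewrite lt_min rho00 ltr01.
move=> r P e1 e2 /andP[r0]; rewrite le_min => /andP[rrho r1] ne1 ne2 trap.
have zero (e u : R) : `|e| = 1 -> 0 <= e * u -> e * u <= 0 -> u = 0.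
  move=> ne h1 h2; apply/eqP; rewrite -normr_eq0 -[`|u|]mul1r -ne -normrM normr_eq0.
  by rewrite eq_le h1 h2.
have apex x : 0 <= e1 * (x.1 - P.1) -> 0 <= e2 * (x.2 - P.2) ->
    e1 * (x.1 - P.1) <= 0 -> e2 * (x.2 - P.2) <= 0 -> x = P.
  move=> h1 h2 h3 h4; have := zero _ _ ne1 h1 h3; have := zero _ _ ne2 h2 h4.
  move=> /subr0_eq h5 /subr0_eq h6; move: h5 h6; case: (x) (P) => [? ?] [? ?] /=.
  by move=> -> ->.
have quarter x : closure S x -> 0 <= e1 * (x.1 - P.1) -> 0 <= e2 * (x.2 - P.2) ->
    `|x.1 - P.1| < r -> `|x.2 - P.2| < r -> `|x.1 - P.1| <= r / 4 /\ `|x.2 - P.2| <= r / 4.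
  move=> Sx q1 q2 n1 n2; have [[_ _ h1 h2]//|[h1 h2]] := trap x Sx n1 n2.
  have -> := apex x q1 q2 h1 h2; rewrite !subrr normr0.
  by rewrite divr_ge0 ?(ltW r0).
have cones x : S x -> 0 <= e1 * (x.1 - P.1) -> 0 <= e2 * (x.2 - P.2) ->
    x <> P -> `|x.1 - P.1| < r -> `|x.2 - P.2| < r ->
    exists i k, near_line w ((t i).2 k) (x.1 - P.1) (x.2 - P.2).
  move=> Sx q1 q2 xP n1 n2.
  have [l1 l2] := quarter x (subset_closure Sx) q1 q2 n1 n2.
  pose n := Num.max `|x.1 - P.1| `|x.2 - P.2|.
  have n0 : 0 < n.
    rewrite lt_max !normr_gt0 -negb_and; apply/negP => /andP[/eqP/subr0_eq h1 /eqP/subr0_eq h2].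
    by apply: xP; move: h1 h2; case: (x) (P) => [? ?] [? ?] /= -> ->.
  have nr : n <= r / 4 by rewrite ge_max l1.
  have xn1 : `|x.1 - P.1| <= n by rewrite le_max lexx.
  have xn2 : `|x.2 - P.2| <= n by rewrite le_max lexx orbT.
  (* The ray from [P] through [x] is followed until [s = T], where its sup-distance to [P] is
     [r / 2]. Beyond [r / 4] the quadrant is empty, so the ray leaves [S] on the way, at a point of
     some boundary curve; the cone condition there scales back to [x]. *)
  pose f s : R * R := (x.1 + s * (x.1 - P.1), x.2 + s * (x.2 - P.2)).
  have f1 s : (f s).1 - P.1 = (1 + s) * (x.1 - P.1) by rewrite /f/=; ring.
  have f2 s : (f s).2 - P.2 = (1 + s) * (x.2 - P.2) by rewrite /f/=; ring.
  pose T := r / 2 / n - 1.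
  have TE : (1 + T) * n = r / 2 by rewrite /T addrC subrK divfK// gt_eqF.
  have T0 : 0 <= T by rewrite subr_ge0 ler_pdivlMr// mul1r; lra.
  have fq s : 0 <= s -> 0 <= e1 * ((f s).1 - P.1) /\ 0 <= e2 * ((f s).2 - P.2).
    by move=> s0; rewrite f1 f2 !(mulrCA _ (1 + s)); split; apply: mulr_ge0; rewrite ?addr_ge0.
  have fn s : 0 <= s <= T -> `|(f s).1 - P.1| < r /\ `|(f s).2 - P.2| < r.
    move=> /andP[s0 sT]; rewrite f1 f2 !normrM ger0_norm ?addr_ge0//.
    have h u : `|u| <= n -> (1 + s) * `|u| < r.
      move=> un; apply: (@le_lt_trans _ _ ((1 + T) * n)); last by rewrite TE ltr_pdivrMr// ltr_pMr// ltr1n.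
      by apply: ler_pM; rewrite ?addr_ge0// lerD2l.
    by split; apply: h.
  have nS : ~ S (f T).
    move=> SfT; have TI : 0 <= T <= T by rewrite T0 lexx.
    have [h1 h2] := fn T TI; have [h3 h4] := fq T T0.
    have [] := quarter _ (subset_closure SfT) h3 h4 h1 h2.
    rewrite f1 f2 !normrM (ger0_norm (addr_ge0 ler01 T0)).
    have : n = `|x.1 - P.1| \/ n = `|x.2 - P.2|.
      by rewrite /n; case: (leP `|x.1 - P.1|); [right|left].
    have r24 : (r / 2 <= r / 4) = false by apply/negbTE; rewrite -ltNge ltr_pM2l// ltf_pV2 ?posrE// ltr_nat.
    by move=> [] <-; rewrite TE r24.
  have [s sI] :=
    @segment_meets_boundary R S x (x.1 - P.1, x.2 - P.2) T T0 Sx nS.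
  rewrite -/(f s) => bs; have [s0 sT] := andP sI.
  have [i _ Giy] : (\bigcup_(i in [set: 'I_m]) G i) (f s) by rewrite -bE.
  have [_ H] := tH i.
  have trapi : quadrant_trap e1 e2 r (G i) P.
    move=> y Gy; apply: trap.
    by have [] : boundary S y by rewrite bE; exists i.
  have [h1 h2] := fn s sI; have [h3 h4] := fq s s0.
  have s1 : 1 + s != 0 by rewrite gt_eqF// ltr_wpDr.
  have fP : f s <> P.
    move=> fE; apply: xP.
    have := f1 s; have := f2 s; rewrite fE !subrr => /esym/eqP + /esym/eqP.
    rewrite !mulf_eq0 (negbTE s1)/= => /eqP/subr0_eq h5 /eqP/subr0_eq h6.
    by move: h5 h6; case: (x) (P) => [? ?] [? ?] /= -> ->.
  have rI : 0 < r <= (t i).1 by rewrite r0 (le_trans rrho).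
  have [k Hk] := H r P e1 e2 rI ne1 ne2 trapi (f s) Giy h3 h4 fP h1 h2.
  by exists i, k; apply: (near_lineZ s1); rewrite -f1 -f2.
move=> z Sz q1 q2 n1 n2; apply: contrapT => zP.
have [l1 l2] := quarter z (subset_closure Sz) q1 q2 n1 n2.
pose n := Num.max `|z.1 - P.1| `|z.2 - P.2|.
have n0 : 0 < n.
  rewrite lt_max !normr_gt0 -negb_and; apply/negP => /andP[/eqP/subr0_eq h1 /eqP/subr0_eq h2].
  by apply: zP; move: h1 h2; case: (z) (P) => [? ?] [? ?] /= -> ->.
have nr : n <= r / 4 by rewrite ge_max l1.
have zn1 : `|z.1 - P.1| <= n by rewrite le_max lexx.
have zn2 : `|z.2 - P.2| <= n by rewrite le_max lexx orbT.
have nE : n = `|z.1 - P.1| \/ n = `|z.2 - P.2|.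
  by rewrite /n; case: (leP `|z.1 - P.1|); [right|left].
clearbody n.
have n1' : n <= 1 by rewrite (le_trans nr)// ler_pdivrMr// mul1r (le_trans r1)// ler1n.
have n2I : 0 < n / 2 <= 1.
  by rewrite divr_gt0//= ler_pdivrMr// mul1r (le_trans n1')// ler1n.
have := dens z (n / 2) Sz n2I.
have mA : measurable (S `&` box z (n / 2) : set (mplane R)).
  by apply: measurableI => //; exact: measurable_box.
apply/negP; rewrite -ltNge.
(* [n] is the sup-distance from [z] to [P]. Within [n / 2] of [z] the dominant coordinate keeps its
   sign, which excludes the opposite quadrant and [P] itself; so all of [S] in this box lies in the
   cones, within [2 n] of [P]. *)
have cover x : (S `&` box z (n / 2)) x -> exists2 i : 'I_m * bool,
    i \in enum {: 'I_m * bool} & strip w (2 * n) ((t i.1).2 i.2) P x.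
  move=> [Sx /boxE[x1 x2]].
  have y1 : `|x.1 - P.1| <= 2 * n by have := ler_distD z.1 x.1 P.1; lra.
  have y2 : `|x.2 - P.2| <= 2 * n by have := ler_distD z.2 x.2 P.2; lra.
  have n2r : 2 * n < r.
    by apply: (@le_lt_trans _ _ (2 * (r / 4))); [rewrite ler_pM2l|clear -r0; lra].
  have y3 : `|x.1 - P.1| < r by exact: le_lt_trans n2r.
  have y4 : `|x.2 - P.2| < r by exact: le_lt_trans n2r.
  have big (e a b : R) : `|e| = 1 -> 0 <= e * b -> n = `|b| -> `|a - b| <= n / 2 -> 0 < e * a.
    move=> ne eb nb ab; have : `|e * (a - b)| <= n / 2 by rewrite normrM ne mul1r.
    have : e * b = n by rewrite -(ger0_norm eb) normrM ne mul1r.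
    by rewrite ler_norml mulrBr => h /andP[h1 _]; lra.
  have pos : 0 < e1 * (x.1 - P.1) \/ 0 < e2 * (x.2 - P.2).
    case: nE => nE; [left; apply: (big e1 _ (z.1 - P.1))|right; apply: (big e2 _ (z.2 - P.2))] => //.
      by have -> : x.1 - P.1 - (z.1 - P.1) = x.1 - z.1 by ring.
    by have -> : x.2 - P.2 - (z.2 - P.2) = x.2 - z.2 by ring.
  have [[h1 h2 _ _]|[h1 h2]] := trap x (subset_closure Sx) y3 y4; last first.
    by case: pos; rewrite ltNge ?h1 ?h2.
  have xP : x <> P by move=> xP; move: pos; rewrite xP !subrr !mulr0 ltxx => -[].
  have [i [k Hik]] := cones x Sx h1 h2 xP y3 y4.
  exists (i, k); first by rewrite mem_enum.
  by apply: near_line_strip => //; exact: ltW.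
have := @measure_le_sum _ _ R (@lebesgue_measure R \x @lebesgue_measure R)%E _ _ _ _ mA
  (fun i => measurable_strip w (2 * n) ((t i.1).2 i.2) P) cover.
move=> /le_lt_trans; apply.
apply: (@le_lt_trans _ _ (\sum_(i <- enum {: 'I_m * bool}) (4 * w * (2 * n) ^+ 2)%:E)%E).
  apply: lee_sum => i _; apply: area_strip; [exact: ltW|lra].
rewrite sumEFin lte_fin big_enum sumr_const card_prod card_ord card_bool.
rewrite -(mulr_natr _ (m * 2)) natrM.
have wE : w * m.+1%:R = c1 / 128 by rewrite /w; field; rewrite addrC natr1 gt_eqF.
have -> : 4 * w * (2 * n) ^+ 2 * (m%:R * 2) = 32 * (w * m.+1%:R) * n ^+ 2 - 32 * w * n ^+ 2.
  by rewrite -(@natr1 R m); ring.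
rewrite wE.
have : 0 < w * n ^+ 2 by rewrite mulr_gt0// exprn_gt0.
have -> : c1 * (n / 2) ^+ 2 = c1 / 4 * n ^+ 2 by field.
by move: (n ^+ 2) => nn; lra.
Qed.

(** * Uniform meshes *)

Lemma cell_domE (R : realType) (N : nat) (h : R) (K : cell N) (x : R * R) :
  cell_dom h K x <-> (K.1%:R * h <= x.1 <= K.1.+1%:R * h) /\
                     (K.2%:R * h <= x.2 <= K.2.+1%:R * h).
Proof. by rewrite /cell_dom /setX/= !in_itv/=. Qed.

Lemma measurable_cell_dom (R : realType) (N : nat) (h : R) (K : cell N) :
  measurable (cell_dom h K : set (mplane R)).
Proof. by apply: measurableX; exact: measurable_itv. Qed.

Lemma area_cell (R : realType) (N : nat) (h : R) (K : cell N) : 0 <= h ->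
  @area R (cell_dom h K) = (h ^+ 2)%:E.
Proof.
move=> h0; rewrite area_rect; last 2 first.
- by rewrite ler_wpM2r// ler_nat.
- by rewrite ler_wpM2r// ler_nat.
by rewrite -!natr1; congr EFin; ring.
Qed.

Lemma segment_cover (R : realType) (N : nat) (h x : R) : N%:R * h = 1 -> 0 <= x <= 1 ->
  exists i : 'I_N, i%:R * h <= x <= i.+1%:R * h.
Proof.
move=> Nh /andP[x0 x1].
have ex : exists i, x <= i.+1%:R * h.
  exists N.-1; case: N Nh => [|N] Nh /=; last by rewrite Nh.
  by move: Nh; rewrite mul0r => /eqP; rewrite eq_sym oner_eq0.
have h0 : 0 < h.
  by rewrite -(pmulr_rgt0 h (_ : 0 < N%:R))// ?Nh// lt_neqAle ler0n andbT;
     apply/eqP => N0; move: Nh; rewrite -N0 mul0r => /eqP; rewrite eq_sym oner_eq0.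
have N0 : (0 < N)%N.
  by rewrite lt0n; apply/eqP => N0; move: Nh; rewrite N0 mul0r => /eqP; rewrite eq_sym oner_eq0.
case: (ex_minnP ex) => i xi imin.
have iN : (i < N)%N.
  by have := imin N.-1; rewrite prednK// Nh => /(_ x1); lia.
exists (Ordinal iN) => /=; rewrite xi andbT.
case: i xi imin {iN} => [|i] xi imin; first by rewrite mul0r.
rewrite leNgt; apply/negP => lt; have := imin i (ltW lt).
by rewrite ltnn.
Qed.

Lemma cell_cover (R : realType) (N : nat) (h : R) (x : R * R) :
  mesh_size N h -> unit_square x -> exists K : cell N, cell_dom h K x.
Proof.
move=> Nh []; rewrite /= !in_itv/= => x1 x2.
have [i Hi] := segment_cover Nh x1; have [j Hj] := segment_cover Nh x2.
by exists (i, j); apply/cell_domE.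
Qed.

(** Sup-distance of the indices at most [k], written with additions to avoid truncated subtraction.
    It replaces neighbourhoods by linear arithmetic on integers. *)
Definition index_near (N : nat) (k : nat) (K K' : cell N) : bool :=
  [&& K'.1 <= K.1 + k, K.1 <= K'.1 + k, K'.2 <= K.2 + k & K.2 <= K'.2 + k]%N.

Lemma share_index_near (N : nat) (K K' : cell N) :
  share_face_or_node K K' -> index_near 1 K K'.
Proof.
rewrite /index_near; case=> [[[[] [a b]] [/=]]|[[a b] [/=]]].
- move=> /andP[/orP H1 /eqP H2] /andP[/orP H3 /eqP H4].
  by case: H1 => /eqP H1; case: H3 => /eqP H3; lia.
- move=> /andP[/eqP H1 /orP H2] /andP[/eqP H3 /orP H4].
  by case: H2 => /eqP H2; case: H4 => /eqP H4; lia.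
rewrite /node_of/= => /andP[/orP H1 /orP H2] /andP[/orP H3 /orP H4].
by case: H1 => /eqP H1; case: H2 => /eqP H2; case: H3 => /eqP H3; case: H4 => /eqP H4; lia.
Qed.

Lemma index_near_share (N : nat) (K K' : cell N) :
  index_near 1 K K' -> share_face_or_node K K'.
Proof.
rewrite /index_near => /and4P[h1 h2 h3 h4]; right.
have l1 : (maxn K.1 K'.1 < N.+1)%N by have := ltn_ord K.1; have := ltn_ord K'.1; lia.
have l2 : (maxn K.2 K'.2 < N.+1)%N by have := ltn_ord K.2; have := ltn_ord K'.2; lia.
by exists (Ordinal l1, Ordinal l2); rewrite /node_of/=; split; lia.
Qed.

(** [K] and [K'] may coincide, so a path through faces is allowed to stay in place. *)
Definition share_face (N : nat) (K K' : cell N) : Prop :=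
  exists F : face N, face_of K F /\ face_of K' F.

Lemma index_near_share_face (N : nat) (K K' : cell N) :
  index_near 1 K K' -> (K.1 == K'.1) || (K.2 == K'.2) -> share_face K K'.
Proof.
rewrite /index_near => /and4P[h1 h2 h3 h4] /orP[/eqP E|/eqP E].
  have l1 : (K.1 < N.+1)%N by rewrite ltnS ltnW.
  have l2 : (maxn K.2 K'.2 < N.+1)%N by have := ltn_ord K.2; have := ltn_ord K'.2; lia.
  by exists (false, (Ordinal l1, Ordinal l2)) => /=; rewrite E eqxx/=; split; lia.
have l1 : (K.2 < N.+1)%N by rewrite ltnS ltnW.
have l2 : (maxn K.1 K'.1 < N.+1)%N by have := ltn_ord K.1; have := ltn_ord K'.1; lia.
by exists (true, (Ordinal l2, Ordinal l1)) => /=; rewrite E eqxx/= andbT; split; lia.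
Qed.

Lemma nbhd_index_near (R : realType) (N : nat) (h : R) (Omega : set (R * R)) (l : nat) (K K' : cell N) :
  nbhd h Omega l K K' -> index_near l K K'.
Proof.
rewrite /index_near; elim: l K' => [|l IH] K' /=; first by move=> ->; rewrite !addn0 !leqnn.
move=> [_ [K'' /IH H1 /share_index_near]]; rewrite /index_near; move: H1; lia.
Qed.

Lemma index_near_dist (R : realType) (N : nat) (h : R) (k : nat) (K K' : cell N) (x z : R * R) :
  0 < h -> index_near k K K' -> cell_dom h K x -> cell_dom h K' z ->
  `|z.1 - x.1| <= k.+1%:R * h /\ `|z.2 - x.2| <= k.+1%:R * h.
Proof.
move=> h0 /and4P[h1 h2 h3 h4] /cell_domE[/andP[x1 x2] /andP[x3 x4]] /cell_domE[/andP[z1 z2] /andP[z3 z4]].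
have le (i j : nat) : (i <= j + k)%N -> i.+1%:R * h <= j%:R * h + k.+1%:R * h.
  by move=> ij; rewrite -mulrDl ler_pM2r// -natrD ler_nat addnS ltnS.
move: h1 h2 h3 h4 => /le h1 /le h2 /le h3 /le h4.
by split; rewrite ler_norml; apply/andP; split; lra.
Qed.

Lemma dist_index_near (R : realType) (N : nat) (h : R) (K K' : cell N) (x z : R * R) :
  0 < h -> cell_dom h K x -> cell_dom h K' z ->
  `|z.1 - x.1| < h -> `|z.2 - x.2| < h -> index_near 1 K K'.
Proof.
move=> h0 /cell_domE[/andP[x1 x2] /andP[x3 x4]] /cell_domE[/andP[z1 z2] /andP[z3 z4]].
rewrite !ltr_norml => /andP[d1 d2] /andP[d3 d4].
have le2 (i j : nat) : i%:R * h < j.+2%:R * h -> (i <= j + 1)%N.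
  by rewrite ltr_pM2r// ltr_nat addn1.
have S (i : nat) : i.+2%:R * h = i.+1%:R * h + h by rewrite -(@natr1 R i.+1) mulrDl mul1r.
by apply/and4P; split; apply: le2; rewrite S; lra.
Qed.

(** Elements are convex: a segment from [x] to a point of the element outside [Omega] would meet the
    boundary inside the element. *)
Lemma cell_in_patch (R : realType) (N : nat) (h : R) (Omega : set (R * R)) (K : cell N) (x : R * R) :
  cell_dom h K x -> Omega x -> ~ (cell_dom h K `&` boundary Omega !=set0) ->
  cell_dom h K `<=` Omega.
Proof.
move=> Kx Ox nb y Ky; apply: contrapT => nOy.
pose v := (y.1 - x.1, y.2 - x.2).
have n1 : ~ Omega (x.1 + 1 * v.1, x.2 + 1 * v.2).
  by rewrite /v/= !mul1r !(addrC x.1) !(addrC x.2) !subrK; case: (y) nOy.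
have [s /andP[s0 s1] bs] := segment_meets_boundary ler01 Ox n1.
apply: nb; eexists; split; last exact: bs.
move: Kx Ky => /cell_domE[/andP[x1 x2] /andP[x3 x4]] /cell_domE[/andP[y1 y2] /andP[y3 y4]].
have conv (a b u w : R) : a <= u <= b -> a <= w <= b -> a <= u + s * (w - u) <= b.
  move=> /andP[u1 u2] /andP[w1 w2].
  have := mulr_ge0 s0 (_ : 0 <= w - a); rewrite subr_ge0 => /(_ w1).
  have := mulr_ge0 s0 (_ : 0 <= b - w); rewrite subr_ge0 => /(_ w2).
  have s1' : 0 <= 1 - s by rewrite subr_ge0.
  have := mulr_ge0 s1' (_ : 0 <= u - a); rewrite subr_ge0 => /(_ u1).
  have := mulr_ge0 s1' (_ : 0 <= b - u); rewrite subr_ge0 => /(_ u2).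
  by clear; rewrite !mulrBl !mulrBr !mul1r => h1 h2 h3 h4; apply/andP; split; lra.
by apply/cell_domE; split; apply: conv; apply/andP; split.
Qed.

Lemma nbhd_self (R : realType) (N : nat) (h : R) (Omega : set (R * R)) (l : nat) (K : cell N) :
  active h Omega K -> nbhd h Omega l K K.
Proof.
move=> aK; elim: l => //= l IH; split => //; exists K => //.
by apply: index_near_share; rewrite /index_near; lia.
Qed.

Lemma nbhd_mono (R : realType) (N : nat) (h : R) (Omega : set (R * R)) (l k : nat) (K K' : cell N) :
  active h Omega K -> (l <= k)%N -> nbhd h Omega l K K' -> nbhd h Omega k K K'.
Proof.
move=> aK /subnK <-; elim: (k - l)%N => // m IH /IH nK'.
rewrite addSn /=; split; last first.
  by exists K' => //; apply: index_near_share; rewrite /index_near; lia.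
(* At level 0 the neighbourhood is [K] alone and its definition does not ask for activity, which
   then comes from [aK]. *)
by case: (m + l)%N nK' => [/= ->|j [//]].
Qed.

(** For each [x] and [r] a mesh is chosen, with [h] at most [h0] and [r / (l + 2)] but at least
    [r / B]. If the element of [x] meets the boundary, the assumption supplies a nearby element with
    a share of [Omega], contained in the box; otherwise the element of [x] lies in [Omega] entirely,
    whence the minimum of [c] and 1. *)
Lemma patch_density (R : realType) (Omega : set (R * R)) (l : nat) (h0 : R) :
  Omega `<=` @unit_square R -> measurable (Omega : set (mplane R)) ->
  patch_geometry Omega l h0 ->
  exists2 c : R, 0 < c & forall x r, Omega x -> 0 < r <= 1 ->
    ((c * r ^+ 2)%:E <= @area R (Omega `&` box x r))%E.
Proof.
move=> OU mO [l0 h00 [c c0 H]].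
(* From [N <= (l + 2) / r + 1 / h0 + 1] and [r <= 1] follows [N r <= B], that is [r / B <= h]. *)
pose B := l.+3%:R + h0^-1.
have B0 : 0 < B by rewrite ltr_wpDr// ?ltr0n// invr_ge0 ltW.
pose c' := Num.min c 1.
have c'0 : 0 < c' by rewrite lt_min c0 ltr01.
exists (c' / B ^+ 2); first by rewrite divr_gt0// exprn_gt0.
move=> x r Ox /andP[r0 r1].
pose M := Num.max (l.+2%:R / r) h0^-1.
have M0 : 0 <= M by rewrite le_max invr_ge0 (ltW h00) orbT.
have /andP[NM MN] := truncn_itv M0.
pose N := (Num.truncn M).+1; pose h : R := N%:R^-1.
have N0 : 0 < N%:R :> R by rewrite ltr0n.
have h_gt0 : 0 < h by rewrite invr_gt0.
have Nh : mesh_size N h by rewrite /mesh_size mulfV// gt_eqF.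
have MN' : M <= N%:R by rewrite ltW.
have hr : l.+2%:R * h <= r.
  rewrite /h ler_pdivrMr// mulrC -ler_pdivrMr//; apply: le_trans MN'.
  by rewrite le_max lexx.
have hh0 : h <= h0.
  rewrite /h invf_ple ?posrE//; apply: le_trans MN'.
  by rewrite le_max lexx orbT.
have rBh : r / B <= h.
  rewrite ler_pdivrMr// /h mulrC ler_pdivlMr// mulrC.
  have : N%:R <= l.+2%:R / r + h0^-1 + 1.
    rewrite /N -natr1 lerD2r; apply: (le_trans NM); rewrite ge_max lerDl lerDr.
    by rewrite invr_ge0 (ltW h00) divr_ge0// ltW.
  rewrite -(ler_pM2r r0) => /le_trans; apply.
  have aux (a b : R) : (a / r + b + 1) * r = a + b * r + r by field; rewrite gt_eqF.
  rewrite aux /B -(@natr1 R l.+2).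
  have : h0^-1 * r <= h0^-1 by rewrite ger_pMr ?invr_gt0.
  by move: (h0^-1 * r) (h0^-1) (l.+2%:R) => a b d; lra.
have [K Kx] := cell_cover Nh (OU _ Ox).
have aK : active h Omega K by exists x.
suff [K' nK' aK'] : exists2 K' : cell N, nbhd h Omega l K K' &
    ((c' * h ^+ 2)%:E <= @area R (cell_dom h K' `&` Omega))%E.
  apply: (@le_trans _ _ (c' * h ^+ 2)%:E).
    rewrite lee_fin -mulrA ler_pM2l// mulrC -expr_div_n.
    by rewrite lerXn2r// nnegrE ?(ltW h_gt0)// divr_ge0// ltW.
  apply: (le_trans aK'); rewrite /area; apply: le_measure; rewrite ?inE.
  - by apply: measurableI => //; exact: measurable_cell_dom.
  - by apply: measurableI => //; exact: measurable_box.
  - move=> z [Kz Oz]; split => //; apply/boxE.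
    have [h1 h2] := index_near_dist h_gt0 (nbhd_index_near nK') Kx Kz.
    have lh : l.+1%:R * h <= r by apply: le_trans hr; rewrite ler_pM2r// ler_nat.
    by split; [exact: le_trans h1 lh|exact: le_trans h2 lh].
have [bK|nbK] := pselect (cell_dom h K `&` boundary Omega !=set0).
  have [|K' nK' aK'] := H N h Nh _ K aK bK; first by rewrite h_gt0.
  exists K' => //; apply: le_trans aK'.
  by rewrite area_cell ?(ltW h_gt0)// -EFinM lee_fin ler_pM2r ?exprn_gt0// ge_min lexx.
exists K; first exact: nbhd_self.
have -> : cell_dom h K `&` Omega = cell_dom h K by apply/setIidPl; exact: (cell_in_patch Kx Ox nbK).
by rewrite area_cell ?(ltW h_gt0)// lee_fin -[leRHS]mul1r ler_pM2r ?exprn_gt0// ge_min lexx orbT.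
Qed.

(** Pigeonhole among the at most nine elements around [K]. With 10 in place of 9 the non-strict
    bounds on the pieces still sum to less than [a]. The common point with [B] locates the element
    found relative to [x]. *)
Lemma nearby_cell_area (R : realType) (Omega B : set (mplane R)) (N : nat) (h a : R)
    (K : cell N) (x : R * R) :
  mesh_size N h -> 0 < h -> Omega `<=` @unit_square R ->
  measurable Omega -> measurable B -> cell_dom h K x ->
  (forall z, B z -> `|z.1 - x.1| < h /\ `|z.2 - x.2| < h) -> 0 < a ->
  (a%:E <= @area R (Omega `&` B))%E ->
  exists K' : cell N, [/\ index_near 1 K K',
    ((a / 10)%:E <= @area R (cell_dom h K' `&` Omega))%E &
    cell_dom h K' `&` (Omega `&` B) !=set0].
Proof.
move=> Nh h_gt0 OU mO mB Kx Bh a0 leA.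
pose s := [seq K' <- enum {: cell N} | index_near 1 K K'].
pose F (K' : cell N) : set (mplane R) := cell_dom h K' `&` (Omega `&` B).
have mF K' : measurable (F K').
  by apply: measurableI; [exact: measurable_cell_dom|exact: measurableI].
suff [K' Ks FK'] : exists2 K', K' \in s & ((a / 10)%:E <= @area R (F K'))%E.
  exists K'; split.
  - by move: Ks; rewrite mem_filter => /andP[].
  - apply: (le_trans FK'); rewrite /area; apply: le_measure; rewrite ?inE//.
      by apply: measurableI => //; exact: measurable_cell_dom.
    by move=> z [? []].
  - apply/set0P/eqP => F0; move: FK'; rewrite /F F0 /area measure0 lee_fin leNgt.
    by rewrite divr_gt0.
apply: contrapT => nex.
have small K' : K' \in s -> (@area R (F K') <= (a / 10)%:E)%E.
  by move=> Ks; rewrite leNgt; apply/negP => lt; apply: nex; exists K' => //; exact: ltW.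
have cover z : (Omega `&` B) z -> exists2 K', K' \in s & F K' z.
  move=> [Oz Bz]; have [K' K'z] := cell_cover Nh (OU _ Oz).
  exists K' => //; rewrite mem_filter mem_enum andbT.
  by have [h1 h2] := Bh z Bz; exact: dist_index_near K'z h1 h2.
have sz : (size s <= 9)%N.
  pose g (K' : cell N) := (val K'.1, val K'.2).
  have gi : injective g.
    move=> [i j] [i' j'] [/= /val_inj e1 /val_inj e2].
    by rewrite e1 e2.
  rewrite -(size_map g).
  pose nb i := [:: i.-1; i; i.+1].
  apply: (@uniq_leq_size _ _ [seq (i, j) | i <- nb (val K.1), j <- nb (val K.2)]).
    by rewrite map_inj_uniq// filter_uniq// enum_uniq.
  move=> _ /mapP[K' + ->]; rewrite mem_filter => /andP[/and4P[h1 h2 h3 h4] _].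
  by apply: allpairs_f; rewrite /nb !inE /=; lia.
have := @measure_le_sum _ _ R (@lebesgue_measure R \x @lebesgue_measure R)%E _ s F _
  (measurableI _ _ mO mB) mF cover.
apply/negP; rewrite -ltNge; apply: lt_le_trans leA.
apply: (@le_lt_trans _ _ (\sum_(K' <- s) (a / 10)%:E)%E).
  rewrite big_seq [leRHS]big_seq; apply: lee_sum => K' Ks; exact: small.
rewrite sumEFin lte_fin big_const_seq count_predT iter_addr_0.
rewrite -(mulr_natr _ (size s)); apply: (@le_lt_trans _ _ (a / 10 * 9%:R)); last first.
  by clear -a0; lra.
by rewrite ler_wpM2l ?ler_nat// divr_ge0// ltW.
Qed.

(** * A path through faces *)

(** One coordinate of two diagonal elements: [P] is the common end point of the two intervals and
    [e] the direction from [P] into the interval of [i]. Used in both coordinates, it yields the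
    common vertex and the quadrants of the trap. *)
Lemma adjacent_axis (R : realType) (h : R) (i j : nat) : 0 < h ->
  i = j.+1 \/ j = i.+1 ->
  exists P e : R,
    [/\ `|e| = 1,
      P = i%:R * h \/ P = i.+1%:R * h,
      forall x, i%:R * h <= x <= i.+1%:R * h -> 0 <= e * (x - P),
      forall x, j%:R * h <= x <= j.+1%:R * h -> e * (x - P) <= 0 &
      (forall x, `|x - P| <= h -> 0 <= e * (x - P) -> i%:R * h <= x <= i.+1%:R * h) /\
      (forall x, `|x - P| <= h -> e * (x - P) <= 0 -> j%:R * h <= x <= j.+1%:R * h)].
Proof.
move=> h0 [->|->].
  exists (j.+1%:R * h), 1; rewrite normr1 -(@natr1 R j.+1) -(@natr1 R j) !mulrDl !mul1r.
  move: (j%:R * h) => a; split => //; [by left|move=> x|move=> x|split => x].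
  - by move=> /andP[? ?]; rewrite mul1r; lra.
  - by move=> /andP[? ?]; rewrite mul1r; lra.
  - by rewrite ler_norml mul1r => /andP[? ?] ?; apply/andP; split; lra.
  - by rewrite ler_norml mul1r => /andP[? ?] ?; apply/andP; split; lra.
exists (i.+1%:R * h), (-1); rewrite normrN normr1 -(@natr1 R i.+1) -(@natr1 R i) !mulrDl !mul1r.
move: (i%:R * h) => a; split => //; [by right|move=> x|move=> x|split => x].
- by move=> /andP[? ?]; rewrite mulN1r; lra.
- by move=> /andP[? ?]; rewrite mulN1r; lra.
- by rewrite ler_norml mulN1r => /andP[? ?] ?; apply/andP; split; lra.
- by rewrite ler_norml mulN1r => /andP[? ?] ?; apply/andP; split; lra.
Qed.

Lemma grid_points_separated (R : realType) (h x P P' : R) (i : nat) :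
  P = i%:R * h \/ P = i.+1%:R * h -> P' = i%:R * h \/ P' = i.+1%:R * h ->
  `|x - P| < h / 2 -> `|x - P'| < h / 2 -> P = P'.
Proof.
rewrite -(@natr1 R i) mulrDl mul1r; move: (i%:R * h) => a.
rewrite !ltr_norml => HP HP' /andP[? ?] /andP[? ?].
by case: HP => HP; case: HP' => HP'; lra.
Qed.

Lemma closure_approx (R : realType) (S : set (R * R)) (x : R * R) (e : R) :
  closure S x -> 0 < e -> exists y, [/\ S y, `|y.1 - x.1| < e & `|y.2 - x.2| < e].
Proof.
move=> clx e0; have [y [Sy [/= h1 h2]]] := clx _ (nbhsx_ballx x e e0).
by exists y; split => //; rewrite distrC.
Qed.

(** The trap concerns the closure, which contains the boundary curves. A point of the closure
    borrows the density from a point of [Omega] within [r / 2], hence the factor 4. *)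
Lemma closure_density (R : realType) (Omega : set (R * R)) (c : R) :
  measurable (Omega : set (mplane R)) ->
  (forall x r, Omega x -> 0 < r <= 1 -> ((c * r ^+ 2)%:E <= @area R (Omega `&` box x r))%E) ->
  forall x r, closure Omega x -> 0 < r <= 1 ->
    ((c / 4 * r ^+ 2)%:E <= @area R (Omega `&` box x r))%E.
Proof.
move=> mO dens x r clx /andP[r0 r1].
have r20 : 0 < r / 2 by rewrite divr_gt0.
have [y [Oy y1 y2]] := closure_approx clx r20.
have r2I : 0 < r / 2 <= 1 by rewrite r20/= ler_pdivrMr// mul1r (le_trans r1)// ler1n.
have -> : c / 4 * r ^+ 2 = c * (r / 2) ^+ 2 by field.
apply: (le_trans (dens y _ Oy r2I)); rewrite /area; apply: le_measure; rewrite ?inE.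
- by apply: measurableI => //; exact: measurable_box.
- by apply: measurableI => //; exact: measurable_box.
move=> z [Oz /boxE[z1 z2]]; split => //; apply/boxE.
split; [have := ler_distD y.1 z.1 x.1|have := ler_distD y.2 z.2 x.2].
  by move: z1 y1; move: `|_| `|_| `|_| => a b d; clear; lra.
by move: z2 y2; move: `|_| `|_| `|_| => a b d; clear; lra.
Qed.

Lemma share_face_refl (N : nat) (K : cell N) : share_face K K.
Proof. by apply: index_near_share_face; [rewrite /index_near; lia|rewrite eqxx]. Qed.

Lemma index_near_sym (N : nat) (K K' : cell N) : index_near 1 K K' -> index_near 1 K' K.
Proof. by rewrite /index_near; lia. Qed.

Lemma index_near_diagonal (N : nat) (K K' : cell N) :
  index_near 1 K K' -> (K.1 == K'.1) || (K.2 == K'.2) = false ->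
  (K.1 = K'.1.+1 :> nat \/ K'.1 = K.1.+1 :> nat) /\
  (K.2 = K'.2.+1 :> nat \/ K'.2 = K.2.+1 :> nat).
Proof.
by move=> /and4P[? ? ? ?] /negbT; rewrite negb_or -!val_eqE /= => /andP[? ?]; lia.
Qed.

Lemma index_near_mixed (N : nat) (K K' : cell N) : index_near 1 K K' ->
  [/\ index_near 1 K (K'.1, K.2), index_near 1 (K'.1, K.2) K',
      index_near 1 K (K.1, K'.2) & index_near 1 (K.1, K'.2) K'].
Proof. by rewrite /index_near /= => /and4P[? ? ? ?]; split; lia. Qed.

(* Cells of the neighbourhood are only required to share nodes, whereas the
   faces carry the penalty: this lemma supplies a path through faces. *)
Lemma face_path_to_large_area (R : realType) (Omega : set (R * R)) (l : nat) (h0 : R) :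
  reference_patch Omega -> patch_geometry Omega l h0 ->
  exists2 c : R, 0 < c & forall (N : nat) (h : R), mesh_size N h -> 0 < h ->
    forall K : cell N, active h Omega K ->
    exists K1 K2 : cell N, [/\ nbhd h Omega 1 K K1, nbhd h Omega 1 K K2,
      share_face K K1, share_face K1 K2 &
      ((c * h ^+ 2)%:E <= @area R (cell_dom h K2 `&` Omega))%E].
Proof.
move=> [OU mO bO] pg.
have [c1 c10 dens] := patch_density OU mO pg.
have cdens := closure_density mO dens.
have [rho rho0 free] := quadrant_trap_free mO bO c10 dens.
(* The scale near a vertex is [r0 = k h]. As [h <= 1], it is at most [rho]; being at most [h / 4],
   it keeps different vertices of an element apart. *)
pose k := Num.min rho (1 / 4); have k0 : 0 < k by rewrite lt_min rho0 divr_gt0.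
have krho : k <= rho by rewrite ge_min lexx.
have k14 : k <= 1 / 4 by rewrite ge_min lexx orbT.
clearbody k.
(* Density of the closure at radius [k h / 8], the smallest used below, divided by 10 for the
   pigeonhole. *)
pose c := c1 / 4 * (k / 8) ^+ 2 / 10.
have c0 : 0 < c by rewrite !(divr_gt0, mulr_gt0, exprn_gt0).
exists c => // N h Nh h_gt0 K aK.
have h1 : h <= 1.
  rewrite -Nh ler_peMl ?(ltW h_gt0)// ler1n lt0n; apply/eqP => N0; move: Nh.
  by rewrite /mesh_size N0 mul0r => /eqP; rewrite eq_sym oner_eq0.
pose r0 := k * h; have r00 : 0 < r0 by rewrite mulr_gt0.
have r0rho : r0 <= rho by rewrite (le_trans _ krho)// ger_pMr.
have r0h : r0 <= h / 4 by rewrite /r0 mulrC ler_pM2l// -div1r.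
have area_c (r : R) : r0 / 8 <= r -> (c * h ^+ 2 <= c1 / 4 * r ^+ 2 / 10).
  move=> le; rewrite /c.
  have -> : c1 / 4 * (k / 8) ^+ 2 / 10 * h ^+ 2 = c1 / 4 / 10 * (r0 / 8) ^+ 2 by rewrite /r0; field.
  have -> : c1 / 4 * r ^+ 2 / 10 = c1 / 4 / 10 * r ^+ 2 by field.
  rewrite ler_pM2l ?divr_gt0// lerXn2r// nnegrE; first by rewrite divr_ge0// ltW.
  by apply: le_trans le; rewrite divr_ge0// ltW.
clearbody c.
have reach (x : R * R) (r : R) : cell_dom h K x -> closure Omega x ->
    r0 / 8 <= r -> r < h -> exists K', [/\ index_near 1 K K',
      ((c * h ^+ 2)%:E <= @area R (cell_dom h K' `&` Omega))%E &
      exists u, [/\ cell_dom h K' u, Omega u, `|u.1 - x.1| <= r & `|u.2 - x.2| <= r]].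
  move=> Kx clx ler rh.
  have r_gt0 : 0 < r by apply: lt_le_trans ler; rewrite divr_gt0.
  have rI : 0 < r <= 1 by rewrite r_gt0 ltW// (lt_le_trans rh).
  have box_h z : box x r z -> `|z.1 - x.1| < h /\ `|z.2 - x.2| < h.
    by move=> /boxE[z1 z2]; split; [exact: le_lt_trans z1 rh|exact: le_lt_trans z2 rh].
  have pos : 0 < c1 / 4 * r ^+ 2 by rewrite mulr_gt0 ?divr_gt0// exprn_gt0.
  have [K' [nK' aK' [u [K'u [Ou /boxE[u1 u2]]]]]] := nearby_cell_area Nh h_gt0 OU mO
    (measurable_box _ _) Kx box_h pos (cdens x r clx rI).
  exists K'; split => //; last by exists u.
  by apply: le_trans aK'; rewrite lee_fin; exact: area_c.
have nb K' : index_near 1 K K' -> active h Omega K' -> nbhd h Omega 1 K K'.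
  by move=> nK' aK'; split => //; exists K => //; exact/index_near_share/index_near_sym.
have by_face K' u : index_near 1 K K' -> (K.1 == K'.1) || (K.2 == K'.2) ->
    cell_dom h K' u -> Omega u -> ((c * h ^+ 2)%:E <= @area R (cell_dom h K' `&` Omega))%E ->
    exists K1 K2 : cell N, [/\ nbhd h Omega 1 K K1, nbhd h Omega 1 K K2,
      share_face K K1, share_face K1 K2 &
      ((c * h ^+ 2)%:E <= @area R (cell_dom h K2 `&` Omega))%E].
  move=> nK' fK' K'u Ou aK'; exists K, K'; split => //.
  - exact: nbhd_self.
  - by apply: nb => //; exists u.
  - exact: share_face_refl.
  - exact: index_near_share_face.
pose corner (P : R * R) := (P.1 = K.1%:R * h \/ P.1 = K.1.+1%:R * h) /\
                           (P.2 = K.2%:R * h \/ P.2 = K.2.+1%:R * h).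
(* If some point [x] of the closure in [K] keeps away from the vertices, the box of radius [r0 / 8]
   around it cannot point to a diagonal element: both coordinates would then be within [r0 / 8] of
   the common vertex. Otherwise the closure in [K] stays within [r0 / 4] of the vertices, which is
   the [r / 4] clause of [quadrant_trap]. *)
have [[x [Kx clx far]]|close] := pselect (exists x, [/\ cell_dom h K x, closure Omega x &
    forall P, corner P -> r0 / 4 <= `|x.1 - P.1| \/ r0 / 4 <= `|x.2 - P.2|]).
  have r08 : r0 / 8 < h by clear -r0h h_gt0 r00; lra.
  have [K' [nK' aK' [u [K'u Ou u1 u2]]]] := reach x (r0 / 8) Kx clx (lexx _) r08.
  have [fK'|fK'] := boolP ((K.1 == K'.1) || (K.2 == K'.2)); first exact: by_face K'u Ou aK'.
  exfalso; have [d1 d2] := index_near_diagonal nK' (negbTE fK').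
  have [P1 [e1 [n1 g1 p1 q1 _]]] := adjacent_axis h_gt0 d1.
  have [P2 [e2 [n2 g2 p2 q2 _]]] := adjacent_axis h_gt0 d2.
  move: Kx K'u => /cell_domE[/p1 x1 /p2 x2] /cell_domE[/q1 y1 /q2 y2].
  have mid (e P a b : R) : `|e| = 1 -> 0 <= e * (a - P) -> e * (b - P) <= 0 ->
      `|b - a| <= r0 / 8 -> `|a - P| < r0 / 4.
    move=> ne ea eb ab.
    have -> : `|a - P| = e * (a - P) by rewrite -(ger0_norm ea) normrM ne mul1r.
    have : `|e * (b - a)| <= r0 / 8 by rewrite normrM ne mul1r.
    rewrite ler_norml => /andP[+ _].
    have -> : e * (b - a) = e * (b - P) - e * (a - P) by ring.
    by move: ea eb; move: (e * _) (e * _) => s t; clear -r00; lra.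
  have m1 := mid _ _ _ _ n1 x1 y1 u1; have m2 := mid _ _ _ _ n2 x2 y2 u2.
  by have [] := far (P1, P2) (conj g1 g2) => /=; rewrite leNgt ?m1 ?m2.
have near_corner x : cell_dom h K x -> closure Omega x ->
    exists P, [/\ corner P, `|x.1 - P.1| < r0 / 4 & `|x.2 - P.2| < r0 / 4].
  move=> Kx clx; apply: contrapT => nP; apply: close; exists x; split => // P cP.
  have [l1|g1] := leP (r0 / 4) `|x.1 - P.1|; first by left.
  have [l2|g2] := leP (r0 / 4) `|x.2 - P.2|; first by right.
  by exfalso; apply: nP; exists P.
have [z [Kz Oz]] := aK.
have r04 : r0 / 4 < h by clear -r0h h_gt0; lra.
have r84 : r0 / 8 <= r0 / 4 by clear -r00; lra.
have [K' [nK' aK' [u [K'u Ou u1 u2]]]] := reach z (r0 / 4) Kz (subset_closure Oz) r84 r04.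
have [fK'|/negbTE fK'] := boolP ((K.1 == K'.1) || (K.2 == K'.2)).
  exact: by_face K'u Ou aK'.
have [d1 d2] := index_near_diagonal nK' fK'.
have [P1 [e1 [n1 g1 p1 q1 [s1 t1]]]] := adjacent_axis h_gt0 d1.
have [P2 [e2 [n2 g2 p2 q2 [s2 t2]]]] := adjacent_axis h_gt0 d2.
have aK'' : active h Omega K' by exists u.
have via (Ka : cell N) : index_near 1 K Ka -> index_near 1 Ka K' ->
    (K.1 == Ka.1) || (K.2 == Ka.2) -> (Ka.1 == K'.1) || (Ka.2 == K'.2) ->
    active h Omega Ka -> exists K1 K2 : cell N, [/\ nbhd h Omega 1 K K1, nbhd h Omega 1 K K2,
      share_face K K1, share_face K1 K2 &
      ((c * h ^+ 2)%:E <= @area R (cell_dom h K2 `&` Omega))%E].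
  move=> nKa nK'a f1 f2 aKa; exists Ka, K'; split => //.
  - exact: nb.
  - exact: nb.
  - exact: index_near_share_face.
  - exact: index_near_share_face.
have [ma1 ma2 mb1 mb2] := index_near_mixed nK'.
have [aKa|naKa] := pselect (active h Omega (K'.1, K.2)).
  by apply: via aKa; rewrite /= ?eqxx ?orbT.
have [aKb|naKb] := pselect (active h Omega (K.1, K'.2)).
  by apply: via aKb; rewrite /= ?eqxx ?orbT.
(* [K'] is diagonal to [K] and both elements in between are inactive: the hypotheses of the trap at
   their common vertex are now assembled. *)
exfalso.
have r0h' : r0 <= h by clear -r0h h_gt0; lra.
have no_a x : Omega x -> `|x.1 - P1| < r0 -> `|x.2 - P2| < r0 ->
    e1 * (x.1 - P1) <= 0 -> 0 <= e2 * (x.2 - P2) -> False.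
  move=> Ox /ltW m1 /ltW m2 o1 o2; apply: naKa; exists x; split => //; apply/cell_domE; split.
    by apply: t1 => //; exact: le_trans r0h'.
  by apply: s2 => //; exact: le_trans r0h'.
have no_b x : Omega x -> `|x.1 - P1| < r0 -> `|x.2 - P2| < r0 ->
    0 <= e1 * (x.1 - P1) -> e2 * (x.2 - P2) <= 0 -> False.
  move=> Ox /ltW m1 /ltW m2 o1 o2; apply: naKb; exists x; split => //; apply/cell_domE; split.
    by apply: s1 => //; exact: le_trans r0h'.
  by apply: t2 => //; exact: le_trans r0h'.
(* Inactivity speaks of [Omega], the trap of its closure. Off the two axes a point of the closure
   has points of [Omega] in the same open quadrant; points on an axis already satisfy the weak
   inequalities of the trap. *)
have approx x : closure Omega x -> `|x.1 - P1| < r0 -> `|x.2 - P2| < r0 ->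
    e1 * (x.1 - P1) != 0 -> e2 * (x.2 - P2) != 0 ->
    exists y, [/\ Omega y, `|y.1 - P1| < r0, `|y.2 - P2| < r0,
      (0 <= e1 * (y.1 - P1)) = (0 <= e1 * (x.1 - P1)) /\ (e1 * (y.1 - P1) <= 0) = (e1 * (x.1 - P1) <= 0) &
      (0 <= e2 * (y.2 - P2)) = (0 <= e2 * (x.2 - P2)) /\ (e2 * (y.2 - P2) <= 0) = (e2 * (x.2 - P2) <= 0)].
  move=> clx m1 m2 z1 z2.
  pose d := Num.min (Num.min (r0 - `|x.1 - P1|) (r0 - `|x.2 - P2|))
                    (Num.min `|e1 * (x.1 - P1)| `|e2 * (x.2 - P2)|).
  have d0 : 0 < d by rewrite !lt_min !subr_gt0 m1 m2 !normr_gt0 z1.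
  have dm1 : d <= r0 - `|x.1 - P1| by rewrite !ge_min lexx.
  have dm2 : d <= r0 - `|x.2 - P2| by rewrite !ge_min lexx !orbT.
  have dz1 : d <= `|e1 * (x.1 - P1)| by rewrite !ge_min lexx !orbT.
  have dz2 : d <= `|e2 * (x.2 - P2)| by rewrite !ge_min lexx !orbT.
  clearbody d; have [y [Oy y1 y2]] := closure_approx clx d0.
  have nearP (a b P : R) : d <= r0 - `|b - P| -> `|a - b| < d -> `|a - P| < r0.
    have := ler_distD b a P; move: `|_| `|_| `|_| => A1 A2 A3; clear; lra.
  have sign (e a b P : R) : `|e| = 1 -> d <= `|e * (b - P)| -> `|a - b| < d ->
      (0 <= e * (a - P)) = (0 <= e * (b - P)) /\ (e * (a - P) <= 0) = (e * (b - P) <= 0).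
    move=> ne db; rewrite -[`|a - b|]mul1r -ne -normrM.
    have -> : e * (a - b) = e * (a - P) - e * (b - P) by ring.
    move: db; move: (e * _) (e * _) => s t; rewrite ltr_norml => + /andP[st ts].
    by have [t0|t0] := leP 0 t; [rewrite ger0_norm//|rewrite ltr0_norm//] => db;
      split; apply/idP/idP; clear -st ts db t0 d0; lra.
  by exists y; split; [|exact: nearP y1|exact: nearP y2|exact: sign|exact: sign].
have trap : quadrant_trap e1 e2 r0 (closure Omega) (P1, P2).
  move=> x clx /= m1 m2.
  have pos : 0 <= e1 * (x.1 - P1) -> 0 <= e2 * (x.2 - P2) ->
      `|x.1 - P1| <= r0 / 4 /\ `|x.2 - P2| <= r0 / 4.
    move=> o1 o2.
    have Kx : cell_dom h K x.
      by apply/cell_domE; split; [apply: s1|apply: s2] => //; rewrite (le_trans (ltW _) r0h').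
    have [[Q1 Q2] [[/= c1' c2'] v1 v2]] := near_corner x Kx clx.
    have r0h2 : r0 < h / 2 by clear -r0h h_gt0; lra.
    have r4h2 : r0 / 4 < h / 2 by clear -r0h h_gt0 r00; lra.
    have -> : P1 = Q1 by apply: (grid_points_separated g1 c1' (lt_trans m1 r0h2) (lt_trans v1 r4h2)).
    have -> : P2 = Q2 by apply: (grid_points_separated g2 c2' (lt_trans m2 r0h2) (lt_trans v2 r4h2)).
    by split; apply: ltW.
  have [z1|z1] := eqVneq (e1 * (x.1 - P1)) 0.
    have [w2|/ltW w2] := leP 0 (e2 * (x.2 - P2)); last by right; rewrite z1.
    have w1 : 0 <= e1 * (x.1 - P1) by rewrite z1.
    by left; have [v1 v2] := pos w1 w2.
  have [z2|z2] := eqVneq (e2 * (x.2 - P2)) 0.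
    have [w1|/ltW w1] := leP 0 (e1 * (x.1 - P1)); last by right; rewrite z2.
    have w2 : 0 <= e2 * (x.2 - P2) by rewrite z2.
    by left; have [v1 v2] := pos w1 w2.
  have [y [Oy y1 y2 [E1 E2] [E3 E4]]] := approx x clx m1 m2 z1 z2.
  have [w1|w1] := leP 0 (e1 * (x.1 - P1)); have [w2|w2] := leP 0 (e2 * (x.2 - P2)).
  - by left; have [v1 v2] := pos w1 w2.
  - by exfalso; apply: (no_b y Oy y1 y2); rewrite ?E1 ?E4// ltW.
  - by exfalso; apply: (no_a y Oy y1 y2); rewrite ?E2 ?E3// ltW.
  - by right; rewrite !ltW.
move: (Kz) (K'u) => /cell_domE[/p1 x1 /p2 x2] /cell_domE[/q1 y1 /q2 y2].
have mid (e P a b : R) : `|e| = 1 -> 0 <= e * (a - P) -> e * (b - P) <= 0 ->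
    `|b - a| <= r0 / 4 -> `|a - P| < r0.
  move=> ne ea eb ab.
  have -> : `|a - P| = e * (a - P) by rewrite -(ger0_norm ea) normrM ne mul1r.
  have : `|e * (b - a)| <= r0 / 4 by rewrite normrM ne mul1r.
  rewrite ler_norml => /andP[+ _].
  have -> : e * (b - a) = e * (b - P) - e * (a - P) by ring.
  by move: ea eb; move: (e * _) (e * _) => s t; clear -r00; lra.
have m1 := mid _ _ _ _ n1 x1 y1 u1; have m2 := mid _ _ _ _ n2 x2 y2 u2.
have r0I : 0 < r0 <= rho by rewrite r00.
have zP := free r0 (P1, P2) e1 e2 r0I n1 n2 trap z Oz x1 x2 m1 m2.
(* [z] is the vertex itself, which also belongs to an element in between, against its inactivity. *)
by apply: (no_a z Oz m1 m2 _ x2); rewrite zP/= subrr mulr0.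
Qed.

(** * Jumps across a face *)

Lemma derive1n_horner_eq (R : realType) (u : R -> R) (f : {poly R}) (a b : R) (k : nat) :
  (forall t, a < t < b -> u t = f.[t]) ->
  forall t, a < t < b -> derive1n k u t = (derivn k f).[t].
Proof.
move=> uf; elim: k => [//|k IH] t /andP[at_ tb].
rewrite derive1nS derivnS derivE !derive1E; apply: near_eq_derive.
have := near_in_itvoo (_ : t \in `]a, b[); rewrite in_itv/= at_ tb => /(_ isT).
by apply: filterS => y; rewrite in_itv/=; exact: IH.
Qed.

(** The one-sided limits see only the open sides, where [u] is a polynomial; derivatives of [u] on
    the face itself do not enter. *)
Lemma derive1n_jump (R : realType) (u : R -> R) (fr fl : {poly R}) (x0 h : R) (k : nat) :
  0 < h -> (forall t, x0 <= t <= x0 + h -> u t = fr.[t]) ->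
  (forall t, x0 - h <= t <= x0 -> u t = fl.[t]) ->
  lim (derive1n k u t @[t --> x0^'+]) - lim (derive1n k u t @[t --> x0^'-]) =
  (derivn k (fr - fl)).[x0].
Proof.
move=> h0 ur ul.
have rE : derive1n k u t @[t --> x0^'+] --> (derivn k fr).[x0].
  have c : (derivn k fr).[t] @[t --> x0^'+] --> (derivn k fr).[x0].
    exact: cvg_at_right_filter (@continuous_horner _ _ _).
  apply: cvg_trans c; apply: near_eq_cvg; near=> t.
  apply/esym/(@derive1n_horner_eq _ _ _ x0 (x0 + h)).
    by move=> s /andP[s1 s2]; rewrite ur// !ltW.
  apply/andP; split; near: t; first exact: nbhs_right_gt.
  by apply: nbhs_right_lt; rewrite ltrDl.
have lE : derive1n k u t @[t --> x0^'-] --> (derivn k fl).[x0].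
  have c : (derivn k fl).[t] @[t --> x0^'-] --> (derivn k fl).[x0].
    exact: cvg_at_left_filter (@continuous_horner _ _ _).
  apply: cvg_trans c; apply: near_eq_cvg; near=> t.
  apply/esym/(@derive1n_horner_eq _ _ _ (x0 - h) x0).
    by move=> s /andP[s1 s2]; rewrite ul// !ltW.
  apply/andP; split; near: t; last exact: nbhs_left_lt.
  by apply: nbhs_left_gt; rewrite ltrBlDr ltrDl.
rewrite (cvg_lim (@Rhausdorff R) rE) (cvg_lim (@Rhausdorff R) lE).
by rewrite derivnB hornerD hornerN.
Unshelve. all: by end_near. Qed.

Lemma sqr_sum_le (R : realType) (I : Type) (r : seq I) (a : I -> R) :
  (\sum_(i <- r) a i) ^+ 2 <= 2 ^+ size r * \sum_(i <- r) a i ^+ 2.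
Proof.
elim: r => [|i r IH]; first by rewrite !big_nil expr0n mulr0.
rewrite !big_cons /= (exprS 2).
have h1 : 0 <= (a i - \sum_(j <- r) a j) ^+ 2 by exact: sqr_ge0.
have h2 : 1 <= 2 ^+ size r :> R by rewrite exprn_ege1// ler1n.
have h3 : a i ^+ 2 <= 2 ^+ size r * a i ^+ 2 by rewrite ler_peMl// sqr_ge0.
move: IH h1 h3; move: (\sum_(j <- r) a j ^+ 2) (\sum_(j <- r) a j) (2 ^+ size r) => A B D.
have : (a i + B) ^+ 2 + (a i - B) ^+ 2 = 2 * a i ^+ 2 + 2 * B ^+ 2 by ring.
have -> : 2 * D * (a i ^+ 2 + A) = 2 * (D * a i ^+ 2) + 2 * (D * A) by ring.
by move: ((a i + B) ^+ 2) ((a i - B) ^+ 2) (D * _) (D * A) => *; lra.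
Qed.

(** The polynomials [F j] do not depend on [s], so a normal derivative at a fixed abscissa is a
    polynomial in the face coordinate. *)
Lemma tensor_poly_slices (R : realType) (p : nat) (q : R * R -> R) : tensor_poly p q ->
  exists F : 'I_p.+1 -> {poly R}, (forall j, (size (F j) <= p.+1)%N) /\
    forall x s, q (x, s) = (\sum_(j < p.+1) s ^+ j *: F j).[x].
Proof.
move=> [c H]; exists (fun j => \poly_(i < p.+1) c (inord i) j); split.
  by move=> j; exact: size_poly.
move=> x s; rewrite H exchange_big /= horner_sum; apply: eq_bigr => j _.
rewrite hornerZ horner_poly mulr_sumr; apply: eq_bigr => i _.
by rewrite inord_val mulrC.
Qed.

(* Taylor expansion across the face; the term of order 0 vanishes because
   both polynomials agree with [u] on the face itself. *)
Lemma jump_bound (R : realType) (p : nat) :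
  exists2 C : R, 0 < C & forall (u : R -> R -> R) (qr ql : R * R -> R) (h x0 s0 : R),
    0 < h -> tensor_poly p qr -> tensor_poly p ql ->
    (forall t s, x0 <= t <= x0 + h -> s0 <= s <= s0 + h -> u t s = qr (t, s)) ->
    (forall t s, x0 - h <= t <= x0 -> s0 <= s <= s0 + h -> u t s = ql (t, s)) ->
    forall t s, x0 - h <= t <= x0 + h -> s0 <= s <= s0 + h ->
    (((qr (t, s) - ql (t, s)) ^+ 2)%:E <= C%:E * \sum_(1 <= k < p.+1)
       ((h ^+ (2 * k - 1))%:E * \int[@lebesgue_measure R]_(y in `[s0, (s0 + h)%R])
          ((lim (derive1n k (u^~ y) x @[x --> x0^'+]) -
            lim (derive1n k (u^~ y) x @[x --> x0^'-])) ^+ 2)%:E))%E.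
Proof.
have [C0 C00 L2] := poly_sup_le_L2 p.+1 (@ltr01 R).
exists (2 ^+ p * C0); first by rewrite mulr_gt0// exprn_gt0.
move=> u qr ql h x0 s0 h0 tr tl ur ul t s tI sI.
have [Fr [sFr qrE]] := tensor_poly_slices tr.
have [Fl [sFl qlE]] := tensor_poly_slices tl.
pose F j := Fr j - Fl j.
pose fr y := \sum_(j < p.+1) y ^+ j *: Fr j.
pose fl y := \sum_(j < p.+1) y ^+ j *: Fl j.
have fE y : fr y - fl y = \sum_(j < p.+1) y ^+ j *: F j.
  by rewrite /fr /fl -sumrB; apply: eq_bigr => j _; rewrite scalerBr.
have sf y : (size (fr y - fl y)%R <= p.+1)%N.
  rewrite fE; apply: (leq_trans (size_sum _ _ _)); apply/bigmax_leqP => j _.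
  apply: (leq_trans (size_scale_leq _ _)); rewrite /F.
  by rewrite (leq_trans (size_polyD _ _))// geq_max sFr size_polyN sFl.
(* The jump of order [k] as a polynomial in the face coordinate: its value at [s] is bounded by its
   L2 norm on the face, at the cost of [C0 / h]. *)
pose g k := \poly_(j < p.+1) (derivn k (F (inord j))).[x0].
have gE k y : (derivn k (fr y - fl y)).[x0] = (g k).[y].
  rewrite fE linear_sum horner_sum horner_poly; apply: eq_bigr => j _ /=.
  by rewrite derivnZ hornerZ inord_val mulrC.
have jE k y : s0 <= y <= s0 + h ->
    lim (derive1n k (u^~ y) x @[x --> x0^'+]) - lim (derive1n k (u^~ y) x @[x --> x0^'-]) = (g k).[y].
  move=> yI; rewrite -gE; apply: (derive1n_jump k h0) => x xI.
    by rewrite ur// qrE.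
  by rewrite ul// qlE.
have int_jE k : (\int[@lebesgue_measure R]_(y in `[s0, (s0 + h)%R])
          ((lim (derive1n k (u^~ y) x @[x --> x0^'+]) -
            lim (derive1n k (u^~ y) x @[x --> x0^'-])) ^+ 2)%:E =
    \int[@lebesgue_measure R]_(y in `[s0, (s0 + h)%R]) ((g k).[y] ^+ 2)%:E)%E.
  by apply: eq_integral => y; rewrite inE/= in_itv/= => yI; rewrite jE.
under eq_bigr do rewrite int_jE.
have I0 k : (0 <= \int[@lebesgue_measure R]_(y in `[s0, (s0 + h)%R]) ((g k).[y] ^+ 2)%:E)%E.
  by apply: integral_ge0 => y _; rewrite lee_fin sqr_ge0.
have gI k : (((g k).[s] ^+ 2)%:E <= (C0 / h)%:E *
    \int[@lebesgue_measure R]_(y in `[s0, (s0 + h)%R]) ((g k).[y] ^+ 2)%:E)%E.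
  apply: (L2 (g k) s0 h `[s0, s0 + h]%classic) => //.
  - exact: size_poly.
  - by rewrite lebesgue_measure_segment ?lerDl ?(ltW h0)// addrAC subrr add0r mul1r.
have dE : qr (t, s) - ql (t, s) = \sum_(1 <= k < p.+1) (derivn k (fr s - fl s)).[x0] / k`!%:R * (t - x0) ^+ k.
  have -> : qr (t, s) - ql (t, s) = (fr s - fl s).[t] by rewrite qrE qlE hornerD hornerN.
  have -> : (fr s - fl s).[t] = (fr s - fl s).[x0 + (t - x0)] by rewrite addrCA subrr addr0.
  (* The expansion is exact, the degree being at most [p]. *)
  rewrite (nderiv_taylor_wide (n := p.+1) (mulrC _ _) (sf s)).
  rewrite -(big_mkord xpredT (fun k => (nderivn k (fr s - fl s)).[x0] * (t - x0) ^+ k)).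
  rewrite big_ltn// nderivn0 expr0 mulr1.
  have -> : (fr s - fl s).[x0] = 0.
    rewrite hornerD hornerN -qrE -qlE -ur// ?lexx ?lerDl ?(ltW h0)//.
    by rewrite -ul// ?lexx ?andbT ?gerBl ?(ltW h0)// subrr.
  rewrite add0r; apply: eq_bigr => k _; congr (_ * _).
  by rewrite nderivn_def hornerMn -[X in _ = X / _]mulr_natr mulfK// pnatr_eq0 -lt0n fact_gt0.
have tx0 : `|t - x0| <= h by move: tI; rewrite ler_norml => /andP[? ?]; apply/andP; split; lra.
have le_real : (qr (t, s) - ql (t, s)) ^+ 2 <=
    2 ^+ p * \sum_(1 <= k < p.+1) h ^+ (2 * k) * (g k).[s] ^+ 2.
  rewrite dE; apply: (le_trans (sqr_sum_le _ _)).
  rewrite size_iota subn1 /= ler_pM2l ?exprn_gt0//.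
  apply: ler_sum => k _; rewrite gE exprMn mulrC; apply: ler_pM; rewrite ?sqr_ge0//.
    rewrite -exprM mulnC exprM [leRHS]exprM lerXn2r ?nnegrE ?sqr_ge0//.
    by rewrite -(real_normK (num_real (t - x0))) lerXn2r// nnegrE ltW.
  rewrite expr_div_n ler_pdivrMr ?exprn_gt0 ?ltr0n ?fact_gt0//.
  by rewrite ler_peMr ?sqr_ge0// exprn_ege1// ler1n fact_gt0.
apply: (@le_trans _ _ (2 ^+ p * \sum_(1 <= k < p.+1) h ^+ (2 * k) * (g k).[s] ^+ 2)%:E).
  by rewrite lee_fin.
rewrite (EFinM (2 ^+ p) C0) (EFinM (2 ^+ p)) -muleA; apply: lee_wpmul2l; first by rewrite lee_fin exprn_ge0.
rewrite -sumEFin ge0_sume_distrr; last first.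
  by move=> k _; apply: mule_ge0 => //; rewrite lee_fin exprn_ge0// ltW.
rewrite big_nat_cond [leRHS]big_nat_cond; apply: lee_sum => k /andP[/andP[k1 _] _].
rewrite [leRHS]muleA -[in leRHS]EFinM (EFinM (h ^+ (2 * k))%R).
apply: (@le_trans _ _ ((h ^+ (2 * k))%:E * ((C0 / h)%:E *
    \int[@lebesgue_measure R]_(y in `[s0, (s0 + h)%R]) ((g k).[y] ^+ 2)%:E))%E).
  by apply: lee_wpmul2l; [rewrite lee_fin exprn_ge0// ltW|exact: gI].
rewrite muleA -EFinM le_eqVlt; apply/orP; left; apply/eqP; congr (_%:E * _)%E.
(* [k1] makes the subtraction genuine; the factor [h] cancels the one in [C0 / h]. *)
have -> : h ^+ (2 * k) = h * h ^+ (2 * k - 1).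
  by rewrite -exprS -subSn ?subn1// muln_gt0.
by move: (h ^+ _) => H; field; rewrite gt_eqF.
Qed.

Lemma face_cells_vertical (N : nat) (K K' : cell N) (a b : 'I_N.+1) :
  K <> K' -> (K'.1 <= K.1)%N && (K'.2 <= K.2)%N ->
  face_of K (true, (a, b)) -> face_of K' (true, (a, b)) ->
  [/\ (K.1 = a :> nat), (a = K'.1.+1 :> nat), (K.2 = b :> nat) & (K'.2 = b :> nat)].
Proof.
move=> neK le /= /andP[/orP h1 /eqP h2] /andP[/orP h3 /eqP h4].
have ne1 : (K.1 != K'.1 :> nat).
  apply/eqP => e1; apply: neK; move: K K' {le h1 h2 h3 h4} e1 (etrans (esym h2) h4) => [i j] [i' j'] /=.
  by move=> /val_inj -> /val_inj ->.
by move: h1 h3 => [] /eqP h1 [] /eqP h3; split; lia.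
Qed.

Lemma face_cells_horizontal (N : nat) (K K' : cell N) (a b : 'I_N.+1) :
  K <> K' -> (K'.1 <= K.1)%N && (K'.2 <= K.2)%N ->
  face_of K (false, (a, b)) -> face_of K' (false, (a, b)) ->
  [/\ (K.2 = b :> nat), (b = K'.2.+1 :> nat), (K.1 = a :> nat) & (K'.1 = a :> nat)].
Proof.
move=> neK le /= /andP[/eqP h2 /orP h1] /andP[/eqP h4 /orP h3].
have ne1 : (K.2 != K'.2 :> nat).
  apply/eqP => e1; apply: neK; move: K K' {le h1 h2 h3 h4} e1 (etrans (esym h2) h4) => [i j] [i' j'] /=.
  by move=> /val_inj -> /val_inj ->.
by move: h1 h3 => [] /eqP h1 [] /eqP h3; split; lia.
Qed.

(** Allows one to assume that [K] lies to the right of [K'] or above it, so that the sides of the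
    jump are known. *)
Lemma face_cells_ordered (N : nat) (K K' : cell N) (F : face N) :
  face_of K F -> face_of K' F ->
  (K'.1 <= K.1)%N && (K'.2 <= K.2)%N \/ (K.1 <= K'.1)%N && (K.2 <= K'.2)%N.
Proof.
case: F => -[] [a b] /=.
  move=> /andP[/orP h1 /eqP h2] /andP[/orP h3 /eqP h4].
  by have [l|l] := leqP K'.1 K.1; [left|right]; lia.
move=> /andP[/eqP h2 /orP h1] /andP[/eqP h4 /orP h3].
by have [l|l] := leqP K'.2 K.2; [left|right]; lia.
Qed.

Lemma face_jump_bound (R : realType) (p : nat) :
  exists2 C : R, 0 < C & forall (N : nat) (h : R) (K K' : cell N) (F : face N)
      (v q q' : R * R -> R), 0 < h -> K <> K' -> face_of K F -> face_of K' F ->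
    tensor_poly p q -> tensor_poly p q' ->
    (forall z, cell_dom h K z -> v z = q z) ->
    (forall z, cell_dom h K' z -> v z = q' z) ->
    forall z, cell_dom h K z \/ cell_dom h K' z ->
    (((q z - q' z) ^+ 2)%:E <= C%:E * \sum_(1 <= k < p.+1) ((h ^+ (2 * k - 1))%:E *
       \int[@lebesgue_measure R]_(s in face_range h F) ((normal_jump h v k F s) ^+ 2)%:E))%E.
Proof.
have [C C0 H] := jump_bound R p; exists C => // N h K K' F v q q' h0.
have S (i : nat) : i.+1%:R * h = i%:R * h + h by rewrite -(@natr1 R i) mulrDl mul1r.
wlog le : K K' q q' / (K'.1 <= K.1)%N && (K'.2 <= K.2)%N => [W neK fK fK' tq tq' vq vq' z Kz|].
  have [le|le] := face_cells_ordered fK fK'; first exact: (W K K').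
  have -> : (q z - q' z) ^+ 2 = (q' z - q z) ^+ 2 by rewrite -sqrrN opprB.
  by apply: (W K' K) => //; [exact: nesym|case: Kz; [right|left]].
case: F => -[] [a b] neK fK fK' tq tq' vq vq' z Kz.
  have [e1 e2 e3 e4] := face_cells_vertical neK le fK fK'.
  rewrite /face_range S; case: z Kz => t s Kz.
  apply: (H (fun t s => v (t, s)) q q' h (a%:R * h) (b%:R * h) h0 tq tq').
  - move=> x y xI yI; apply: vq; apply/cell_domE => /=; rewrite !S e1 e3.
    by split.
  - move=> x y xI yI; apply: vq'; apply/cell_domE => /=; rewrite e4 !S yI -S -e2.
    by move: xI; rewrite {1}e2 S addrK.
  - by case: Kz => /cell_domE/= [/andP[t1 t2] _]; move: t1 t2;
      rewrite S ?e1; rewrite ?e2 ?S; move: (_%:R * h) => A t1 t2; apply/andP; split; lra.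
  - by case: Kz => /cell_domE/= [_ t1]; move: t1; rewrite S ?e3 ?e4.
have [e1 e2 e3 e4] := face_cells_horizontal neK le fK fK'.
rewrite /face_range S; case: z Kz => t s Kz.
(* A horizontal face becomes vertical after exchanging the coordinates. *)
apply: (H (fun s t => v (t, s)) (fun z => q (z.2, z.1)) (fun z => q' (z.2, z.1)) h (b%:R * h) (a%:R * h) h0
  (tensor_poly_swap tq) (tensor_poly_swap tq') _ _ s t).
- move=> x y xI yI; apply: vq; apply/cell_domE => /=; rewrite !S e1 e3.
  by split.
- move=> x y xI yI; apply: vq'; apply/cell_domE => /=; rewrite e4 !S yI -S -e2.
  by move: xI; rewrite {1}e2 S addrK.
- by case: Kz => /cell_domE/= [_ /andP[t1 t2]]; move: t1 t2;
    rewrite S ?e1; rewrite ?e2 ?S; move: (_%:R * h) => A t1 t2; apply/andP; split; lra.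
- by case: Kz => /cell_domE/= [t1 _]; move: t1; rewrite S ?e3 ?e4.
Qed.

Lemma active_tensor_poly (R : realType) (N : nat) (h : R) (Omega : set (R * R)) (p : nat)
    (v : R * R -> R) (K : cell N) :
  active_space N h Omega p v -> active h Omega K ->
  exists2 q, tensor_poly p q & forall z, cell_dom h K z -> v z = q z.
Proof.
move=> [w [_ wK] vw] aK; have [c Hc] := wK K.
exists (fun z => \sum_(i < p.+1) \sum_(j < p.+1) c i j * z.1 ^+ i * z.2 ^+ j).
  by exists c.
by move=> z Kz; rewrite -Hc//; apply: vw; exists K.
Qed.

Lemma jump_L2sq_ge0 (R : realType) (N : nat) (h : R) (v : R * R -> R) (k : nat) (FF : set (face N)) :
  (0 <= jump_L2sq h v k FF)%E.
Proof.
by apply: sume_ge0 => F _; apply: integral_ge0 => s _; rewrite lee_fin sqr_ge0.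
Qed.

Lemma ghost_normsq_ge0 (R : realType) (N : nat) (h : R) (p : nat) (gamma : nat -> R)
    (FF : set (face N)) (v : R * R -> R) :
  0 <= h -> (forall k, (1 <= k <= p)%N -> 0 < gamma k) -> (0 <= ghost_normsq h p gamma FF v)%E.
Proof.
move=> h0 g0; rewrite /ghost_normsq big_nat_cond; apply: sume_ge0 => k /andP[kI _].
apply: mule_ge0; last exact: jump_L2sq_ge0.
by rewrite lee_fin mulr_ge0 ?exprn_ge0// ltW// g0.
Qed.

Lemma ghost_normsq_ge (R : realType) (p : nat) (gamma : nat -> R) :
  (forall k, (1 <= k <= p)%N -> 0 < gamma k) ->
  exists2 g : R, 0 < g & forall (N : nat) (h : R) (FF : set (face N)) (F : face N) (v : R * R -> R),
    0 < h -> FF F ->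
    (g%:E * \sum_(1 <= k < p.+1) ((h ^+ (2 * k - 1))%:E *
       \int[@lebesgue_measure R]_(s in face_range h F) ((normal_jump h v k F s) ^+ 2)%:E) <=
     ghost_normsq h p gamma FF v)%E.
Proof.
move=> g0; have [g gp gH] : exists2 m : R, 0 < m & forall i : 'I_p, m <= gamma i.+1.
  by apply: finite_pos_lower_bound => i; apply: g0; rewrite /= ltn_ord.
exists g => // N h FF F v h0 FFF.
have I0 k G : (0 <= \int[@lebesgue_measure R]_(s in face_range h G) ((normal_jump h v k G s) ^+ 2)%:E)%E.
  by apply: integral_ge0 => s _; rewrite lee_fin sqr_ge0.
have H0 k : 0 <= h ^+ k by rewrite exprn_ge0// ltW.
rewrite ge0_sume_distrr; last by move=> k _; apply: mule_ge0; rewrite ?lee_fin.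
rewrite /ghost_normsq big_nat_cond [leRHS]big_nat_cond; apply: lee_sum => k /andP[/andP[k1 kp] _].
rewrite muleA -EFinM; apply: lee_pmul => //.
- by rewrite lee_fin mulr_ge0// ltW.
- rewrite lee_fin ler_wpM2r//.
  have kp' : (k.-1 < p)%N by rewrite prednK.
  by have := gH (Ordinal kp'); rewrite /= prednK.
rewrite /jump_L2sq (bigD1 F) ?mem_set//= leeDl//.
by apply: sume_ge0.
Qed.

Lemma L2sq_le_sup (R : realType) (D : set (mplane R)) (q : R * R -> R) (X : \bar R) (m : R) :
  measurable D -> measurable_fun D (q : mplane R -> R) -> @area R D = m%:E ->
  (0 <= X)%E -> (forall z, D z -> ((q z ^+ 2)%:E <= X)%E) -> (L2sq D q <= m%:E * X)%E.
Proof.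
move=> mD mq aD X0 H; rewrite -aD muleC /area -integral_cst//.
apply: ge0_le_integral => //.
- by move=> z _; rewrite lee_fin sqr_ge0.
- by apply/measurable_EFinP; exact: measurable_funX.
Qed.

(** One square of side [3 h] holds [K] and all its neighbours, so the Remez inequality can compare
    two of them. *)
Lemma cell_in_square (R : realType) (N : nat) (h : R) (K K' : cell N) :
  0 < h -> index_near 1 K K' ->
  cell_dom h K' `<=` `[K.1%:R * h - h, K.1%:R * h - h + 3 * h] `*` `[K.2%:R * h - h, K.2%:R * h - h + 3 * h].
Proof.
move=> h0 /and4P[l1 l2 l3 l4] z /cell_domE[/andP[z1 z2] /andP[z3 z4]].
have le (i j : nat) : (i <= j + 1)%N -> i%:R * h <= j%:R * h + h.
  by move=> ij; rewrite -[X in _ + X]mul1r -mulrDl ler_pM2r// natr1 ler_nat -addn1.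
have S (i : nat) : i.+1%:R * h = i%:R * h + h by rewrite -(@natr1 R i) mulrDl mul1r.
move: l1 l2 l3 l4 z2 z4 => /le l1 /le l2 /le l3 /le l4; rewrite !S => z2 z4.
by split; rewrite /= in_itv/=; apply/andP; split; lra.
Qed.

(** * Transfer through faces *)

Lemma index_near_refl (N k : nat) (K : cell N) : index_near k K K.
Proof. by rewrite /index_near; lia. Qed.

Lemma L2sq_ge0 (R : realType) (D : set (R * R)) (v : R * R -> R) : (0 <= L2sq D v)%E.
Proof. by apply: integral_ge0 => z _; rewrite lee_fin sqr_ge0. Qed.

(** On [K] the polynomial [q'] of the neighbour is controlled by its L2 norm on [S], and [q - q'] by
    the jumps across the common face. The two bounds are pointwise and are integrated over [K] at
    the end. *)
Lemma L2sq_face_transfer (R : realType) (p : nat) (gamma : nat -> R) (c : R) :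
  (forall k, (1 <= k <= p)%N -> 0 < gamma k) -> 0 < c ->
  exists2 C : R, 0 < C & forall (N : nat) (h : R) (K K' : cell N) (FF : set (face N))
      (v q q' : R * R -> R) (S : set (mplane R)), 0 < h <= 1 ->
    share_face K K' -> (forall F, K <> K' -> face_of K F -> face_of K' F -> FF F) ->
    tensor_poly p q -> tensor_poly p q' ->
    (forall z, cell_dom h K z -> v z = q z) ->
    (forall z, cell_dom h K' z -> v z = q' z) ->
    measurable S -> S `<=` cell_dom h K' -> ((c * h ^+ 2)%:E <= @area R S)%E ->
    (L2sq (cell_dom h K) v <= C%:E * (L2sq S v + ghost_normsq h p gamma FF v))%E.
Proof.
move=> g0 c0.
(* [c h^2] is the fraction [c / 9] of the square of side [3 h]. *)
have c90 : 0 < c / 9 by rewrite divr_gt0.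
have [C1 C10 HL2] := tensor_poly_sup_le_L2 p c90.
have [C2 C20 HJ] := face_jump_bound R p.
have [g gp HG] := ghost_normsq_ge g0.
pose C := 2 * C1 + 2 * (C2 / g).
have Cg0 : 0 < C2 / g by rewrite divr_gt0.
have C0 : 0 < C by rewrite addr_gt0// mulr_gt0.
exists C => // N h K K' FF v q q' S /andP[h0 h1] [F [fK fK']] HFF tq tq' vq vq' mS SK' aS.
set G := ghost_normsq h p gamma FF v; set A := L2sq S v.
have G0 : (0 <= G)%E by apply: ghost_normsq_ge0 => //; exact: ltW.
have A0 : (0 <= A)%E by exact: L2sq_ge0.
have h20 : 0 < h ^+ 2 by rewrite exprn_gt0.
have AE : A = L2sq S q'.
  by apply: eq_integral => z; rewrite inE => Sz; rewrite vq'//; exact: SK'.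
have nK : index_near 1 K K'.
  by apply: share_index_near; left; exists F.
have sub z : cell_dom h K z -> ((q' z ^+ 2)%:E <= (C1 / h ^+ 2)%:E * A)%E.
  move=> Kz; have h30 : 0 < 3 * h by rewrite mulr_gt0.
  have nKK := index_near_refl 1 K.
  have := HL2 q' _ _ (3 * h) S tq' h30 mS (subset_trans SK' (cell_in_square h0 nK)) _ z
    (cell_in_square h0 nKK Kz).
  have -> : c / 9 * (3 * h) ^+ 2 = c * h ^+ 2 by field.
  move=> /(_ aS) /le_trans; apply; rewrite -AE; apply: lee_wpmul2r => //.
  rewrite lee_fin ler_pM2l// lef_pV2 ?posrE// ?exprn_gt0// exprMn.
  by rewrite ler_peMl ?(ltW h20)// exprn_ege1// ler1n.
have dif z : cell_dom h K z -> (((q z - q' z) ^+ 2)%:E <= (C2 / g)%:E * G)%E.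
  move=> Kz; have [KK'|neK] := pselect (K = K').
    rewrite -vq// -vq' -?KK'// subrr expr0n/=.
    by apply: mule_ge0 => //; rewrite lee_fin ltW.
  have := HJ N h K K' F v q q' h0 neK fK fK' tq tq' vq vq' z (or_introl Kz).
  move=> /le_trans; apply.
  rewrite -[in leLHS](@divfK _ g (lt0r_neq0 gp) C2) EFinM -muleA; apply: lee_wpmul2l.
    by rewrite lee_fin ltW.
  by apply: HG => //; exact: HFF.
(* The bound by jumps has no factor [1 / h^2]; [h <= 1] lets it be absorbed. The area [h^2] of [K]
   then cancels the denominator. *)
pose X := ((C / h ^+ 2)%:E * (A + G))%E.
have X0 : (0 <= X)%E.
  by apply: mule_ge0; [rewrite lee_fin divr_ge0// ltW|exact: adde_ge0].
have pt z : cell_dom h K z -> ((q z ^+ 2)%:E <= X)%E.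
  move=> Kz.
  have le2 : q z ^+ 2 <= 2 * q' z ^+ 2 + 2 * (q z - q' z) ^+ 2.
    by have := sqr_ge0 (q z - 2 * q' z); move: (q z) (q' z) => a b; nra.
  apply: (@le_trans _ _ (2 * q' z ^+ 2 + 2 * (q z - q' z) ^+ 2)%:E); first by rewrite lee_fin.
  rewrite EFinD (EFinM 2) (EFinM 2).
  apply: (@le_trans _ _ (2%:E * ((C1 / h ^+ 2)%:E * A) + 2%:E * ((C2 / g)%:E * G))%E).
    by apply: leeD; apply: lee_wpmul2l => //; [exact: sub|exact: dif].
  have -> : X = ((C / h ^+ 2)%:E * A + (C / h ^+ 2)%:E * G)%E by rewrite /X ge0_muleDr.
  rewrite !muleA -!EFinM; apply: leeD; apply: lee_wpmul2r => //; rewrite lee_fin.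
    by rewrite mulrA ler_pM2r ?invr_gt0// /C lerDl mulr_ge0// ltW.
  rewrite (@le_trans _ _ C)//; first by rewrite /C lerDr mulr_ge0// ltW.
  by rewrite ler_pdivlMr// ger_pMr// exprn_ile1// ltW.
have -> : (C%:E * (A + G) = (h ^+ 2)%:E * X)%E.
  by rewrite /X muleA -EFinM mulrC divfK// gt_eqF.
have -> : L2sq (cell_dom h K) v = L2sq (cell_dom h K) q.
  by apply: eq_integral => z; rewrite inE => Kz; rewrite vq.
apply: L2sq_le_sup => //; last 1 first.
- by apply: area_cell; exact: ltW.
- exact: measurable_cell_dom.
- by apply: measurable_funTS; exact: tensor_poly_measurable tq.
Qed.

(** The values of [v] off the active elements are arbitrary, so measurability on the neighbourhood
    has to be assembled element by element. *)
Lemma measurable_fin_cover (R : realType) (I : finType) (S : set I) (D : I -> set (mplane R))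
    (f : mplane R -> R) :
  (forall i, measurable (D i)) -> (forall i, S i -> measurable_fun (D i) f) ->
  measurable_fun (\bigcup_(i in S) D i) f.
Proof.
move=> mD mf _ Y mY; rewrite setI_bigcupl.
by apply: fin_bigcup_measurable => [|i Si]; [exact: finite_finset|exact: mf].
Qed.

Theorem lemma4p2 (R : realType) (Omega : set (R * R)) (p : nat)
    (gamma : nat -> R) (l : nat) (h0 : R) :
  reference_patch Omega ->
  (1 <= p)%N ->
  (forall k : nat, (1 <= k <= p)%N -> 0 < gamma k) ->
  patch_geometry Omega l h0 ->
  exists2 C : R, 0 < C &
    forall (N : nat) (h : R), mesh_size N h -> 0 < h <= h0 ->
    forall K : cell N, active h Omega K ->
      cell_dom h K `&` boundary Omega !=set0 ->
    forall v : R * R -> R, active_space N h Omega p v ->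
      (L2sq (cell_dom h K) v <=
       C%:E * (L2sq (union_dom h (nbhd h Omega l K) `&` Omega) v +
               ghost_normsq h p gamma
                 (interior_faces (nbhd h Omega l K)) v))%E.
Proof.
move=> ref p1 g0 pg.
have [OU mO _] := ref.
have [l0 _ _] := pg.
have [c c0 HG] := face_path_to_large_area ref pg.
(* Two crossings: from the share [c] of [K2] to [K1], then from the whole of [K1], share 1, to [K].
   The jumps enter at both, whence [C2 * (C1 + 1)]. *)
have [C1 C10 T1] := L2sq_face_transfer g0 c0.
have [C2 C20 T2] := L2sq_face_transfer g0 (@ltr01 R).
exists (C2 * (C1 + 1)); first by rewrite mulr_gt0// addr_gt0.
move=> N h Nh /andP[h_gt0 _] K aK _ v av.
have h1 : h <= 1.
  rewrite -Nh ler_peMl ?(ltW h_gt0)// ler1n lt0n; apply/eqP => N0; move: Nh.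
  by rewrite /mesh_size N0 mul0r => /eqP; rewrite eq_sym oner_eq0.
have hI : 0 < h <= 1 by rewrite h_gt0.
have [K1 [K2 [nK1 nK2 sK1 sK2 aK2]]] := HG N h Nh h_gt0 K aK.
have aK1 : active h Omega K1 by case: nK1.
have aK2' : active h Omega K2 by case: nK2.
have mono := nbhd_mono aK l0.
(* As [l >= 1], the path lies in the l-th neighbourhood, so the faces it crosses are among the
   penalized ones. *)
have {}nK1 := mono _ nK1; have {}nK2 := mono _ nK2.
have nK : nbhd h Omega l K K by exact: nbhd_self.
have [q tq vq] := active_tensor_poly av aK.
have [q1 tq1 vq1] := active_tensor_poly av aK1.
have [q2 tq2 vq2] := active_tensor_poly av aK2'.
set FF := interior_faces _; set G := ghost_normsq _ _ _ _ _.
have faces Ka Kb F : nbhd h Omega l K Ka -> nbhd h Omega l K Kb ->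
    Ka <> Kb -> face_of Ka F -> face_of Kb F -> FF F.
  by move=> na nb neK fa fb; exists Ka, Kb.
have mS : measurable (cell_dom h K2 `&` Omega : set (mplane R)).
  by apply: measurableI => //; exact: measurable_cell_dom.
have st1 := T1 N h K1 K2 FF v q1 q2 _ hI sK2 (fun F => faces K1 K2 F nK1 nK2) tq1 tq2 vq1 vq2
  mS (@subIsetl _ _ _) aK2.
have aK1E : ((1 * h ^+ 2)%:E <= @area R (cell_dom h K1))%E.
  by rewrite area_cell ?(ltW h_gt0)// mul1r.
have st2 := T2 N h K K1 FF v q q1 _ hI sK1 (fun F => faces K K1 F nK nK1) tq tq1 vq vq1
  (@measurable_cell_dom R N h K1) (@subset_refl _ _) aK1E.
have G0 : (0 <= G)%E by apply: ghost_normsq_ge0 => //; exact: ltW.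
set A := L2sq (union_dom _ _ `&` _) v.
have A0 : (0 <= A)%E by exact: L2sq_ge0.
have leA : (L2sq (cell_dom h K2 `&` Omega) v <= A)%E.
  have mDi (K' : cell N) : measurable (cell_dom h K' `&` Omega : set (mplane R)).
    by apply: measurableI => //; exact: measurable_cell_dom.
  have UE : union_dom h (nbhd h Omega l K) `&` Omega =
      \bigcup_(K' in nbhd h Omega l K) (cell_dom h K' `&` Omega).
    by rewrite /union_dom setI_bigcupl.
  rewrite /A /L2sq UE; apply: ge0_subset_integral => //.
  - by apply: fin_bigcup_measurable => [|K' _]; [exact: finite_finset|exact: mDi].
  - apply/measurable_EFinP; apply: measurable_funX.
    apply: measurable_fin_cover => // K' nK'.
    have aK' : active h Omega K' by case: (l) l0 nK' => // l' _ [].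
    have [q' tq' vq'] := active_tensor_poly av aK'.
    apply: (@eq_measurable_fun _ _ _ _ _ q').
      by move=> z; rewrite inE => -[K'z _]; rewrite vq'.
    by apply: measurable_funTS; exact: tensor_poly_measurable tq'.
  - by move=> z _; rewrite lee_fin sqr_ge0.
  - by move=> z Kz; exists K2.
apply: (le_trans st2); rewrite EFinM -muleA; apply: lee_wpmul2l; first by rewrite lee_fin ltW.
apply: (@le_trans _ _ (C1%:E * (A + G) + G)%E).
  apply: leeD => //; apply: (le_trans st1); apply: lee_wpmul2l; first by rewrite lee_fin ltW.
  exact: leeD.
rewrite EFinD ge0_muleDl ?lee_fin ?(ltW C10)// mul1e.
by rewrite leeD2l// leeDr.
Qed.
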